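(* Let $k\geq1$ be an integer, let $a$, $b$ and $x_0$ be finite real numbers with $a<b$, and let $v:\mathbb{R}\to\mathbb{C}$ be a $\mathcal{C}^k$-function such that $\mathrm{supp}\,v\subseteq[-1,1]$. Let $V$ be the element of $L^2(\mathbb{R})$ whose Fourier transform is given by $$\forall\,p\in\mathbb{R}\qquad \widehat V(p)=v\!\left(\frac{2p-(a+b)}{b-a}\right)e^{-ix_0p}.$$ Then $\widehat V$ is a $\mathcal{C}^k$-function on $\mathbb{R}$ with $\mathrm{supp}\,\widehat V\subseteq[a,b]$, and $$\forall\,c>0\qquad\int_{|x-x_0|\geq c}|V(x)|^2\,dx\leq\frac{2}{c^2}\,\frac{1}{b-a}\,\|v'\|_{L^2(\mathbb{R})}^2 .$$
   Context: Fourier transform convention: $\widehat f(p)=\int_{\mathbb{R}}f(x)e^{-ixp}dx$, extended to $L^2(\mathbb{R})$. *)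

(* Defs.v *)
From HB Require Import structures.
From mathcomp Require Import all_boot all_order all_algebra.
From mathcomp Require Import all_classical all_reals all_analysis.
From mathcomp Require Import complex.
Set Implicit Arguments.
Unset Strict Implicit.
Unset Printing Implicit Defensive.
Import Order.TTheory GRing.Theory Num.Theory.
Import numFieldNormedType.Exports.
Local Open Scope classical_set_scope.
Local Open Scope ring_scope.
Local Open Scope complex_scope.

(* R[i] is not a normed module over R in the libraries, so differentiation,
   integration and measurability of functions R -> R[i] are componentwise. *)

Notation leb R := (@lebesgue_measure R) (only parsing).

Definition Cderive1 (R : realType) (f : R -> R[i]) : R -> R[i] :=
  fun x => derive1 (fun t => complex.Re (f t)) x +i* derive1 (fun t => complex.Im (f t)) x.

Definition isCk (R : realType) (k : nat) (f : R -> R) : Prop :=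
  (forall j : nat, (j < k)%N -> forall x : R, derivable (derive1n j f) x 1) /\
  continuous (derive1n k f).

Definition CisCk (R : realType) (k : nat) (f : R -> R[i]) : Prop :=
  isCk k (fun x => complex.Re (f x)) /\ isCk k (fun x => complex.Im (f x)).

Definition supp (R : realType) (f : R -> R[i]) : set R :=
  closure [set x | f x != 0].

Definition CLfun (R : realType) (p : \bar R) (f : R -> R[i]) : Prop :=
  (fun x => complex.Re (f x)) \in Lfun (leb R) p /\
  (fun x => complex.Im (f x)) \in Lfun (leb R) p.

Definition CLnorm (R : realType) (p : \bar R) (f : R -> R[i]) : \bar R :=
  Lnorm (leb R) p (fun x => (ComplexField.Normc.normc (f x))%:E).

Definition Cintegral (R : realType) (f : R -> R[i]) : R[i] :=
  Rintegral (leb R) setT (fun x => complex.Re (f x)) +i*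
  Rintegral (leb R) setT (fun x => complex.Im (f x)).

Definition expi (R : realType) (t : R) : R[i] := cos t +i* sin t.

Definition fourierL1 (R : realType) (f : R -> R[i]) : R -> R[i] :=
  fun p => Cintegral (fun x => f x * expi (- (x * p))).

(* [g] represents the transform of the L2 function [f], i.e. its image under
   the extension by L2-continuity of [fourierL1] from the intersection of L1
   and L2.  As functions are not quotiented, [g] is only determined almost
   everywhere. *)
Definition is_fourierL2 (R : realType) (f g : R -> R[i]) : Prop :=
  [/\ CLfun 2%:E f, CLfun 2%:E g &
   exists u : nat -> R -> R[i],
     [/\ forall n, CLfun 1%E (u n) /\ CLfun 2%:E (u n),
         CLnorm 2%:E (fun x => u n x - f x) @[n --> \oo] --> 0%E &
         CLnorm 2%:E (fun p => fourierL1 (u n) p - g p) @[n --> \oo] --> 0%E]].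

(* Main.v *)
(** Only one half of Plancherel's theorem is needed: [2 pi * int |u|^2 <= int |u^|^2]
    for integrable [u].  Weighting [|w^|^2] by [exp (- e |p|)] turns it into the
    Poisson kernel applied to [w], which tends to [2 pi int |w|^2] as [e -> 0] when
    [w] is integrable, bounded and continuous; a general [u] is reached through its
    moving averages [w], whose transforms are dominated by that of [u], by Lebesgue
    differentiation and Fatou's lemma.

    Multiplying [u] by [exp (i h (x - x0)) - 1] corresponds to taking a finite
    difference of the transform.  Passing to the limit along the approximating
    sequence bounds [int |exp (i h (x - x0)) - 1|^2 |V|^2] by the [L2] norm of a
    finite difference of [v]; dividing by [h^2] and letting [h -> 0] gives
    [int (x - x0)^2 |V|^2 <= 2 / (b - a) * int |v'|^2], and Chebyshev's inequality
    concludes. *)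

Require Import Defs.
From HB Require Import structures.
From mathcomp Require Import all_boot all_order all_algebra.
From mathcomp Require Import all_classical all_reals all_analysis.
From mathcomp Require Import measurable_realfun.
From mathcomp Require Import complex.
From mathcomp Require Import ring lra.
Set Implicit Arguments.
Unset Strict Implicit.
Unset Printing Implicit Defensive.
Import Order.TTheory GRing.Theory Num.Theory.
Import numFieldNormedType.Exports.
Local Open Scope classical_set_scope.
Local Open Scope ring_scope.
Local Open Scope complex_scope.

(** * Integration *)

Section lebesgue_tools.
Context {R : realType}.
Local Notation mu := (@lebesgue_measure R).

(** [V] is reached only through a sequence of integrable functions whose transforms converge in L2,
    so information has to flow from the transform back to the function. Bounding the L2 norm of a
    function by that of its transform is enough for this, and no inversion formula enters. The
    approximants need not decay, so their transforms need not be differentiable and [x - x0] cannot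
    be used as a multiplier directly. The multiplier [expi (h * (x - x0)) - 1] has modulus at most
    2: it preserves integrability and L2 convergence. Centring it at [x0] makes the phases of [Vhat]
    and of its translate agree, which leaves a difference of [v] alone. The factor [2 / (b - a)] is
    the slope of the affine map from [a, b] onto [-1, 1]: differentiation contributes its square and
    the change of variable divides by it once. The exact Plancherel identity would give
    [1 / (pi * (b - a))]; the spare factor [2 * pi] pays for crude quadratic inequalities. *)

Lemma affine_preimage_ocitv (al be a b : R) : 0 < al ->
  (fun x => al * x + be) @^-1` `]a, b] = `](a - be) / al, (b - be) / al]%classic.
Proof.
move=> al0; apply/seteqP; split => x /=; rewrite !in_itv /= ltr_pdivrMr//
  ler_pdivlMr// ltrBlDr lerBrDr mulrC//.
Qed.

Lemma continuous_affine (al be : R) : continuous (fun x : R => al * x + be).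
Proof.
move=> x; apply: cvgD; last exact: cvg_cst.
by apply: cvgM; [exact: cvg_cst|exact: cvg_id].
Qed.

Lemma measurable_affine (al be : R) :
  measurable_fun setT (fun x : R => al * x + be).
Proof. by apply: continuous_measurable_fun; exact: continuous_affine. Qed.

(** Uniqueness of Lebesgue measure: the image of [mu] under the affine map, multiplied by [al],
    gives every half-open interval its length, hence is [mu]. *)
Lemma ge0_integral_affine (al be : R) (g : R -> \bar R) : 0 < al ->
  measurable_fun setT g -> (forall x, 0 <= g x)%E ->
  (\int[mu]_x g (al * x + be)%R = (al^-1)%:E * \int[mu]_x g x)%E.
Proof.
move=> al0 mg g0.
have al_ge0 := ltW al0.
pose phi := (fun x : R => al * x + be).
have mphi : measurable_fun [set: R] (phi : R -> measurableTypeR R).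
  exact: measurable_affine.
pose push : {measure set (measurableTypeR R) -> \bar R} :=
  measure_function_pushforward__canonical__measure_function_Measure mu mphi.
pose nu := mscale (NngNum al_ge0) push.
have nuE A : measurable A -> mu A = nu A.
  apply: lebesgue_measure_unique => _ [[a b]] _ <-.
  rewrite /nu/= /mscale/= /pushforward affine_preimage_ocitv//.
  rewrite !lebesgue_measure_itv/= !lte_fin ltr_pM2r ?invr_gt0// ltrD2r.
  case: ifP => _; last by rewrite mule0.
  rewrite -!EFinD -EFinM; congr EFin.
  by field; rewrite gt_eqF.
rewrite [in RHS](eq_measure_integral nu); last by move=> A mA _; exact: nuE.
rewrite ge0_integral_mscale//= muleA -EFinM mulVf ?gt_eqF// mul1e.
by rewrite ge0_integral_pushforward.
Qed.

Lemma integral_affine (al be : R) (g : R -> \bar R) : 0 < al ->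
  mu.-integrable setT g ->
  (\int[mu]_x g (al * x + be)%R = (al^-1)%:E * \int[mu]_x g x)%E.
Proof.
move=> al0 ig; have mg := measurable_int _ ig.
rewrite integralE [in RHS]integralE muleBr//; last first.
  by rewrite fin_num_adde_defl// fin_numN integrable_neg_fin_num.
congr (_ - _)%E; rewrite -(ge0_integral_affine be al0)//.
- by apply: eq_integral => x _; rewrite !funeposE.
- exact: measurable_funepos.
- by apply: eq_integral => x _; rewrite !funenegE.
- exact: measurable_funeneg.
Qed.

Lemma integrable_affine (al be : R) (g : R -> \bar R) : 0 < al ->
  mu.-integrable setT g ->
  mu.-integrable setT (fun x => g (al * x + be)%R).
Proof.
move=> al0 /integrableP[mg ig]; apply/integrableP; split.
  by apply: measurableT_comp mg _; exact: measurable_affine.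
rewrite (ge0_integral_affine be al0 (g := fun x => `|g x|%E))//.
  by apply: lte_mul_pinfty => //; rewrite lee_fin invr_ge0 ltW.
exact: measurableT_comp.
Qed.

End lebesgue_tools.

Section general_tools.
Context d (T : measurableType d) (R : realType).
Variable mu : {measure set T -> \bar R}.

(** Fatou's lemma in the form used below: the integrals of the [f_ n] are only bounded by a
    convergent sequence, and [f] is only an almost everywhere limit, hence almost everywhere equal
    to the lower limit. *)
Lemma fatou_cvg (D : set T) (f_ : (T -> \bar R)^nat) (f : T -> \bar R)
    (c_ : (\bar R)^nat) (c : \bar R) : measurable D ->
  (forall n, measurable_fun D (f_ n)) ->
  measurable_fun D f ->
  (forall n x, D x -> 0 <= f_ n x)%E ->
  {ae mu, forall x, D x -> f_ ^~ x @ \oo --> f x} ->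
  (forall n, \int[mu]_(x in D) f_ n x <= c_ n)%E ->
  c_ @ \oo --> c ->
  (\int[mu]_(x in D) f x <= c)%E.
Proof.
move=> mD mf_ mf f0 aef lec cc.
have -> : (\int[mu]_(x in D) f x = \int[mu]_(x in D) limn_einf (f_ ^~ x))%E.
  apply: ae_eq_integral => //.
    apply: (eq_measurable_fun (fun x => - limn_esup (fun n => - f_ n x)))%E.
      by move=> x _; rewrite -limn_einfN; congr limn_einf; apply/funext => n /=; rewrite oppeK.
    apply: measurableT_comp => //; apply: measurable_fun_limn_esup => n.
    exact: measurableT_comp.
  apply: filterS aef => x fx Dx; apply/esym.
  by have := cvg_limn_einf_sup (fx Dx) => -[].
apply: (le_trans (fatou mu mD mf_ f0)).
have [<- _] := cvg_limn_einf_sup cc.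
rewrite !limn_einf_lim; apply: lee_lim.
- exact: is_cvg_einfs.
- exact: is_cvg_einfs.
apply: nearW => n; apply: le_ereal_inf_tmp => _ [m /= nm <-].
by apply: le_trans (lec m); apply: ereal_inf_lbound; exists m.
Qed.

End general_tools.

(** * Fubini's theorem for bounded kernels *)

Section fubini_kernel.
Context {R : realType}.
Local Notation mu := (@lebesgue_measure R).
Variables (phi w : R -> R) (B : R * R -> R).
Hypotheses (iphi : mu.-integrable setT (EFin \o phi))
  (iw : mu.-integrable setT (EFin \o w))
  (mB : measurable_fun setT B) (B1 : forall z, `|B z| <= 1).

Let F (z : R * R) := (phi z.1 * (w z.2 * B z))%:E.

Let mphi : measurable_fun setT phi.
Proof. by apply/measurable_EFinP; exact: measurable_int iphi. Qed.
Let mw : measurable_fun setT w.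
Proof. by apply/measurable_EFinP; exact: measurable_int iw. Qed.

Let mF : measurable_fun setT F.
Proof.
apply/measurable_EFinP; apply: measurable_funM.
  exact: measurableT_comp.
apply: measurable_funM => //.
exact: measurableT_comp.
Qed.

Lemma integrable_kernel1 p : mu.-integrable setT (EFin \o (fun x => w x * B (p, x))).
Proof.
apply: le_integrable iw => //.
  apply/measurable_EFinP/measurable_funM => //.
  exact: measurableT_comp.
move=> x _ /=; rewrite lee_fin normrM -[leRHS]mulr1.
exact: ler_wpM2l.
Qed.

Lemma integrable_kernel2 x : mu.-integrable setT (EFin \o (fun p => phi p * B (p, x))).
Proof.
apply: le_integrable iphi => //.
  apply/measurable_EFinP/measurable_funM => //.
  exact: measurableT_comp.
move=> p _ /=; rewrite lee_fin normrM -[leRHS]mulr1.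
exact: ler_wpM2l.
Qed.

Let iF : (mu \x mu)%E.-integrable setT F.
Proof.
have ZE p : (\int[mu]_y (`|phi p|%:E * `|w y|%:E) = `|phi p|%:E * \int[mu]_y `|w y|%:E)%E.
  by rewrite ge0_integralZl//; apply/measurable_EFinP; exact: measurableT_comp.
apply/integrable12ltyP => //.
apply: (@le_lt_trans _ _ (\int[mu]_x \int[mu]_y (`|phi x|%:E * `|w y|%:E))%E).
  apply: ge0_le_integral => //=.
  - by move=> x _; exact: integral_ge0.
  - apply: (@measurable_fun_fubini_tonelli_F _ _ _ _ _ mu (abse \o F)).
      exact: measurableT_comp.
    by move=> z; exact: abse_ge0.
  - rewrite (_ : (fun x => _) = (fun p => `|phi p|%:E * \int[mu]_y `|w y|%:E)%E); last first.
      by apply/funext => p; rewrite ZE.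
    apply: emeasurable_funM => //.
    by apply/measurable_EFinP; exact: measurableT_comp.
  - move=> x _; apply: ge0_le_integral => //=.
    + apply/measurable_EFinP; apply: measurableT_comp => //.
      apply: measurable_funM => //; apply: measurable_funM => //.
      exact: measurableT_comp.
    + apply: emeasurable_funM => //.
      by apply/measurable_EFinP; exact: measurableT_comp.
    move=> y _; rewrite -EFinM lee_fin !normrM.
    by apply: ler_wpM2l => //; rewrite -[leRHS]mulr1; exact: ler_wpM2l.
under eq_integral do rewrite ZE.
move: iphi iw => /integrableP[_ /= fp] /integrableP[_ /= fw].
rewrite ge0_integralZr//; first by rewrite lte_mul_pinfty//; [exact: integral_ge0|
  rewrite ge0_fin_numE// ; exact: integral_ge0].
- by apply/measurable_EFinP; exact: measurableT_comp.
- exact: integral_ge0.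
Qed.

(** The product of [phi] with the transform of [w] is thus again an admissible weight [phi], so the
    exchange of integrals can be iterated. *)
Lemma integrable_Fubini_kernel :
  mu.-integrable setT (EFin \o (fun p => phi p * \int[mu]_x (w x * B (p, x)))).
Proof.
apply: eq_integrable (integrable_fubini_F iF) => //= p _.
rewrite /fubini_F /F/=; under eq_integral do rewrite EFinM.
rewrite integralZl//; last exact: integrable_kernel1.
rewrite EFinM /Rintegral fineK// integrable_fin_num//.
exact: integrable_kernel1.
Qed.

Lemma Fubini_kernel :
  \int[mu]_p (phi p * \int[mu]_x (w x * B (p, x))) =
  \int[mu]_x (w x * \int[mu]_p (phi p * B (p, x))).
Proof.
congr fine.
transitivity (\int[mu]_p \int[mu]_x F (p, x))%E.
  apply: eq_integral => p _; rewrite /F/=; under [RHS]eq_integral do rewrite EFinM.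
  rewrite integralZl//; last exact: integrable_kernel1.
  rewrite EFinM /Rintegral fineK// integrable_fin_num//.
  exact: integrable_kernel1.
rewrite (Fubini iF); apply: eq_integral => x _; rewrite /F/=.
under eq_integral do rewrite mulrCA EFinM.
rewrite integralZl//; last exact: integrable_kernel2.
rewrite EFinM /Rintegral fineK// integrable_fin_num//.
exact: integrable_kernel2.
Qed.

End fubini_kernel.

Lemma integrable_Fubini_kernel_swap {R : realType} (phi w : R -> R) (B : R * R -> R) :
  (@lebesgue_measure R).-integrable setT (EFin \o phi) ->
  (@lebesgue_measure R).-integrable setT (EFin \o w) ->
  measurable_fun setT B -> (forall z, `|B z| <= 1) ->
  (@lebesgue_measure R).-integrable setT
    (EFin \o (fun x => w x * \int[@lebesgue_measure R]_p (phi p * B (p, x)))).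
Proof.
move=> iphi iw mB B1.
apply: (@integrable_Fubini_kernel _ w phi (B \o (fun z => (z.2, z.1)))) => //.
  by apply: measurableT_comp => //; exact: measurable_fun_pair.
by move=> z; exact: B1.
Qed.

(** * The Poisson kernel and Plancherel's inequality for real functions *)

Section poisson_kernel.
Context {R : realType}.
Local Notation mu := (@lebesgue_measure R).

Lemma continuous_measurableT (f : R -> R) : continuous f -> measurable_fun setT f.
Proof. exact: continuous_measurable_fun. Qed.

Lemma continuous_cosM (t : R) : continuous (fun p : R => cos (t * p)).
Proof.
move=> p; apply: (@continuous_comp _ _ _ (fun p : R => t * p) cos); last exact: continuous_cos.
by apply: cvgM; [exact: cvg_cst|exact: cvg_id].
Qed.

Lemma continuous_sinM (t : R) : continuous (fun p : R => sin (t * p)).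
Proof.
move=> p; apply: (@continuous_comp _ _ _ (fun p : R => t * p) sin); last exact: continuous_sin.
by apply: cvgM; [exact: cvg_cst|exact: cvg_id].
Qed.

Lemma normr_cos_le1 (x : R) : `|cos x| <= 1.
Proof. by rewrite ler_norml cos_geN1 cos_le1. Qed.

Lemma normr_sin_le1 (x : R) : `|sin x| <= 1.
Proof. by rewrite ler_norml sin_geN1 sin_le1. Qed.

(** This is the real part of [e / (e - i t)], the characteristic function of the exponential law. It
    equals [1 / (1 + (t / e)^2)], the Poisson kernel up to normalisation. *)
Lemma integral_exponential_pdf_cos (e t : R) : 0 < e ->
  \int[mu]_p (exponential_pdf e p * cos (t * p)) = e ^+ 2 / (e ^+ 2 + t ^+ 2).
Proof.
move=> e0.
have ie := integrable_exponential_pdf e0.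
have iec : mu.-integrable setT (EFin \o (fun p => exponential_pdf e p * cos (t * p))).
  apply: le_integrable ie => //.
    apply/measurable_EFinP/measurable_funM; first exact: measurable_exponential_pdf.
    by apply: continuous_measurableT; exact: continuous_cosM.
  move=> p _ /=; rewrite lee_fin normrM -[leRHS]mulr1.
  by apply: ler_wpM2l => //; exact: normr_cos_le1.
have e2t2 : 0 < e ^+ 2 + t ^+ 2 by rewrite ltr_pwDl ?exprn_gt0 ?sqr_ge0.
(* The fundamental theorem of calculus on a half-line is only available for
   nonnegative integrands, hence [1 + cos]. *)
suff: \int[mu]_p (exponential_pdf e p * (1 + cos (t * p))) = 1 + e ^+ 2 / (e ^+ 2 + t ^+ 2).
  under eq_Rintegral do rewrite mulrDr mulr1.
  by rewrite RintegralD//= {1}/Rintegral integral_exponential_pdf//= => /addrI.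
(* [F] is the real part of the complex antiderivative [- exp (- e p) - e / (e - i t) * exp (- (e - i
   t) p)]. *)
pose F : R -> R := fun p => - expR (- e * p) +
  e * expR (- e * p) * (t * sin (t * p) - e * cos (t * p)) / (e ^+ 2 + t ^+ 2).
have dF (p : R) : is_derive p (1 : R) F (e * expR (- e * p) * (1 + cos (t * p))).
  rewrite /F; apply: is_derive_eq.
  rewrite /GRing.scale/=; field; rewrite gt_eqF//.
have cF : continuous F.
  by move=> p; apply: differentiable_continuous; apply/derivable1_diffP; case: (dF p).
have F0 : F 0 = - 1 - e ^+ 2 / (e ^+ 2 + t ^+ 2).
  by rewrite /F !mulr0 expR0 sin0 cos0; field; rewrite gt_eqF.
rewrite -[RHS]/(fine (1 + e ^+ 2 / (e ^+ 2 + t ^+ 2))%:E); congr fine.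
transitivity (\int[mu]_(p in `[0%R, +oo[) (exponential_pdf e p * (1 + cos (t * p)))%:E)%E.
  rewrite [RHS]integral_mkcond; apply: eq_integral => p _.
  rewrite patchE; case: ifPn => //; rewrite notin_setE/= in_itv/= andbT => /negP.
  by rewrite -ltNge => p0; rewrite lt0_exponential_pdf// mul0r.
rewrite (@ge0_continuous_FTC2y _ _ F _ 0) => //.
- by rewrite F0 -EFinB; congr EFin; ring.
- move=> p p0; rewrite mulr_ge0 ?exponential_pdf_ge0 ?(ltW e0)//.
- have cE : continuous (fun p : R => e * expR (- e * p) * (1 + cos (t * p))).
    move=> p; apply: differentiable_continuous; apply/derivable1_diffP.
    exact: ex_derive.
  apply: subspace_eq_continuous (continuous_subspaceT cE) => p.
  by rewrite inE/= in_itv/= andbT => p0; rewrite /from_subspace/= exponential_pdfE.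
- apply/cvgr0Pnorm_le => d d0.
  have : expR (- e * p) @[p --> +oo] --> (0 : R).
    rewrite (_ : (fun p => expR (- e * p)) = (fun z => expR (- z)) \o (fun p => e * p)); last first.
      by apply: eq_fun => p; rewrite mulNr.
    apply: (@cvg_comp _ _ _ _ _ _ (pinfty_nbhs R)); last exact: cvgr_expR.
    exact: gt0_cvgMry.
  (* [C] bounds [F p / expR (- e * p)] uniformly in [p], because the sine and the cosine are at most
     1 in absolute value. *)
  pose C := 1 + e * (`|t| + e) / (e ^+ 2 + t ^+ 2).
  move=> E0; have : expR (- e * p) * C @[p --> +oo] --> 0 * C.
    by apply: cvgM => //; exact: cvg_cst.
  rewrite mul0r => /cvgr0_norm_le/(_ _ d0); apply: filterS => p; apply: le_trans.
  have -> : F p = expR (- e * p) * (- 1 + e * (t * sin (t * p) - e * cos (t * p)) / (e ^+ 2 + t ^+ 2)).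
    by rewrite /F; field; rewrite gt_eqF.
  rewrite !normrM ler_wpM2l// [leRHS]ger0_norm; last first.
    rewrite /C addr_ge0// divr_ge0 ?(ltW e2t2)// mulr_ge0 ?(ltW e0)//.
    by rewrite addr_ge0 ?(ltW e0).
  rewrite /C (le_trans (ler_normD _ _))// normrN1 lerD2l !normrM (gtr0_norm e0).
  rewrite normfV (gtr0_norm e2t2) ler_pM2r ?invr_gt0//.
  rewrite ler_pM2l// (le_trans (ler_normB _ _))// !normrM (gtr0_norm e0) lerD//.
    by rewrite -[leRHS]mulr1 ler_wpM2l// normr_sin_le1.
  by rewrite -[leRHS]mulr1 ler_wpM2l ?(ltW e0)// normr_cos_le1.
- by apply/cvg_at_right_filter; exact: cF.
- move=> p; rewrite in_itv/= andbT => p0.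
  by rewrite derive1E (@derive_val _ _ _ _ _ _ _ (dF p)) exponential_pdfE// ltW.
Qed.

Lemma measurable_oneDsqrV : measurable_fun setT (fun s : R => (oneDsqr s)^-1).
Proof. by apply: continuous_measurableT; exact: continuous_oneDsqrV. Qed.

Lemma oneDsqrV_ge0 (s : R) : 0 <= (oneDsqr s)^-1.
Proof. by rewrite invr_ge0 (le_trans _ (oneDsqr_ge1 s)). Qed.

Lemma integralT_oneDsqrV : (\int[mu]_s ((oneDsqr s)^-1)%:E = (@pi R)%:E)%E.
Proof.
rewrite ge0_symfun_integralT//=.
- rewrite (_ : [set x | _] = `[0, +oo[%classic); last first.
    by apply/seteqP; split => x/=; rewrite in_itv/= andbT.
  by rewrite integral0y_oneDsqr -EFinM mulrC divfK.
- exact: continuous_oneDsqrV.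
- by move=> x/=; rewrite /oneDsqr sqrrN.
Qed.

Lemma integrable_oneDsqrV : mu.-integrable setT (EFin \o (fun s => (oneDsqr s)^-1)).
Proof.
apply/integrableP; split.
  by apply/measurable_EFinP; exact: measurable_oneDsqrV.
under eq_integral do rewrite /= ger0_norm ?oneDsqrV_ge0//.
by rewrite integralT_oneDsqrV ltry.
Qed.

End poisson_kernel.

(** * Cosine and sine transforms *)

Section cos_sin_transforms.
Context {R : realType}.
Local Notation mu := (@lebesgue_measure R).
Implicit Types f w : R -> R.

(** For a real integrable [f] the Fourier transform is [cosT f - i sinT f], so
    [cosT f p ^+ 2 + sinT f p ^+ 2] is its squared modulus. The analysis can then stay in the
    reals. *)
Definition cosT f (p : R) := \int[mu]_x (f x * cos (x * p)).
Definition sinT f (p : R) := \int[mu]_x (f x * sin (x * p)).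

Lemma measurable_cos_prod : measurable_fun setT (fun z : R * R => cos (z.2 * z.1)).
Proof.
apply: (measurableT_comp (f := cos)).
  by apply: continuous_measurableT; exact: continuous_cos.
by apply: measurable_funM.
Qed.

Lemma measurable_sin_prod : measurable_fun setT (fun z : R * R => sin (z.2 * z.1)).
Proof.
apply: (measurableT_comp (f := sin)).
  by apply: continuous_measurableT; exact: continuous_sin.
by apply: measurable_funM.
Qed.

Lemma integrable_bounded_mul f (b : R -> R) : mu.-integrable setT (EFin \o f) ->
  measurable_fun setT b -> (forall x, `|b x| <= 1) ->
  mu.-integrable setT (EFin \o (fun x => f x * b x)).
Proof.
move=> fi mb b1; apply: le_integrable (fi) => //.
  apply/measurable_EFinP/measurable_funM => //.
  by apply/measurable_EFinP; exact: measurable_int fi.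
move=> x _ /=; rewrite lee_fin normrM -[leRHS]mulr1.
exact: ler_wpM2l.
Qed.

Lemma measurable_cos_lin (p : R) : measurable_fun setT (fun x : R => cos (x * p)).
Proof.
under eq_fun do rewrite mulrC.
by apply: continuous_measurableT; exact: continuous_cosM.
Qed.

Lemma measurable_sin_lin (p : R) : measurable_fun setT (fun x : R => sin (x * p)).
Proof.
under eq_fun do rewrite mulrC.
by apply: continuous_measurableT; exact: continuous_sinM.
Qed.

Lemma integrable_cosT f p : mu.-integrable setT (EFin \o f) ->
  mu.-integrable setT (EFin \o (fun x => f x * cos (x * p))).
Proof.
move=> fi; apply: integrable_bounded_mul => //; first exact: measurable_cos_lin.
by move=> x; exact: normr_cos_le1.
Qed.

Lemma integrable_sinT f p : mu.-integrable setT (EFin \o f) ->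
  mu.-integrable setT (EFin \o (fun x => f x * sin (x * p))).
Proof.
move=> fi; apply: integrable_bounded_mul => //; first exact: measurable_sin_lin.
by move=> x; exact: normr_sin_le1.
Qed.

Lemma continuous_param (f : R -> R) (h : R -> R -> R) :
  mu.-integrable setT (EFin \o f) ->
  (forall p, measurable_fun setT (h p)) ->
  (forall p x, `|h p x| <= 1) -> (forall x, continuous (h^~ x)) ->
  continuous (fun p => \int[mu]_x (f x * h p x)).
Proof.
move=> fi mh h1 ch p.
have := @continuity_under_integral R _ _ mu (fun p x => f x * h p x) setT measurableT (p - 1) (p + 1).
move=> /(_ _ _ (fun x => `|f x|) _ _ p); apply.
- by move=> q _; exact: integrable_bounded_mul.
- apply: aeW => x _ q _; apply: cvgM; first exact: cvg_cst.
  exact: ch.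
- exact: integrable_norm.
- move=> q _; apply: aeW => x _; rewrite normrM -[leRHS]mulr1.
  exact: ler_wpM2l.
- by rewrite inE/= in_itv/= ltrDl ltr01 ltrBlDr ltrDl ltr01.
Qed.

Lemma continuous_cosT f : mu.-integrable setT (EFin \o f) -> continuous (cosT f).
Proof.
move=> fi; apply: continuous_param => //.
- exact: measurable_cos_lin.
- by move=> *; exact: normr_cos_le1.
- exact: continuous_cosM.
Qed.

Lemma continuous_sinT f : mu.-integrable setT (EFin \o f) -> continuous (sinT f).
Proof.
move=> fi; apply: continuous_param => //.
- exact: measurable_sin_lin.
- by move=> *; exact: normr_sin_le1.
- exact: continuous_sinM.
Qed.

(** Each square is a double integral in [x] and [y]. Two exchanges bring the [p] integral innermost,
    where [cos (x p) cos (y p) + sin (x p) sin (y p) = cos ((x - y) p)], whose exponential mean is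
    the Poisson kernel. *)
Lemma poisson_energy f (e : R) : 0 < e -> mu.-integrable setT (EFin \o f) ->
  \int[mu]_p (exponential_pdf e p * (cosT f p ^+ 2 + sinT f p ^+ 2)) =
  \int[mu]_x (f x * \int[mu]_y (f y * (oneDsqr ((x - y) / e))^-1)).
Proof.
move=> e0 fi; have ie := integrable_exponential_pdf e0.
have nc z : `|(fun z : R * R => cos (z.2 * z.1)) z| <= 1 by exact: normr_cos_le1.
have ns z : `|(fun z : R * R => sin (z.2 * z.1)) z| <= 1 by exact: normr_sin_le1.
have iC := integrable_Fubini_kernel ie fi measurable_cos_prod nc.
have iS := integrable_Fubini_kernel ie fi measurable_sin_prod ns.
have iCC := integrable_Fubini_kernel iC fi measurable_cos_prod nc.
have iSS := integrable_Fubini_kernel iS fi measurable_sin_prod ns.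
have FC := Fubini_kernel iC fi measurable_cos_prod nc.
have FS := Fubini_kernel iS fi measurable_sin_prod ns.
transitivity (\int[mu]_p (exponential_pdf e p * cosT f p * cosT f p) +
              \int[mu]_p (exponential_pdf e p * sinT f p * sinT f p)).
  rewrite -RintegralD//; first by apply: eq_Rintegral => p _; ring.
rewrite FC FS -RintegralD//; last 2 first.
- exact: (integrable_Fubini_kernel_swap iC fi measurable_cos_prod nc).
- exact: (integrable_Fubini_kernel_swap iS fi measurable_sin_prod ns).
apply: eq_Rintegral => x _; rewrite -mulrDr; congr (_ * _).
have iec := integrable_cosT x ie.
have ies := integrable_sinT x ie.
transitivity (\int[mu]_p (exponential_pdf e p * cos (p * x) * cosT f p) +
              \int[mu]_p (exponential_pdf e p * sin (p * x) * sinT f p)).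
  congr (_ + _); apply: eq_Rintegral => p _; rewrite (mulrC p x) /cosT /sinT; ring.
rewrite (Fubini_kernel iec fi measurable_cos_prod nc).
rewrite (Fubini_kernel ies fi measurable_sin_prod ns).
rewrite -RintegralD//; last 2 first.
- exact: (integrable_Fubini_kernel_swap iec fi measurable_cos_prod nc).
- exact: (integrable_Fubini_kernel_swap ies fi measurable_sin_prod ns).
apply: eq_Rintegral => y _; rewrite -mulrDr; congr (_ * _).
rewrite -RintegralD//; last 2 first.
- exact: (integrable_kernel2 iec measurable_cos_prod nc y).
- exact: (integrable_kernel2 ies measurable_sin_prod ns y).
have -> : (oneDsqr ((x - y) / e))^-1 = e ^+ 2 / (e ^+ 2 + (x - y) ^+ 2).
  have ? : e ^+ 2 + (x - y) ^+ 2 != 0 by rewrite gt_eqF// ltr_pwDl ?exprn_gt0 ?sqr_ge0.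
  have ? : e != 0 by rewrite gt_eqF.
  by rewrite /oneDsqr expr_div_n -[1](@divff _ (e ^+ 2)) ?expf_neq0// -mulrDl invf_div.
rewrite -integral_exponential_pdf_cos//; apply: eq_Rintegral => p _ /=.
by rewrite mulrBl cosB (mulrC x p) (mulrC y p); ring.
Qed.

End cos_sin_transforms.

Lemma dominated_Rintegral_cvg d (T : measurableType d) (R : realType)
    (mu : {measure set T -> \bar R}) (f_ : (T -> R)^nat) (f g : T -> R) :
  (forall n, measurable_fun setT (f_ n)) -> measurable_fun setT f ->
  {ae mu, forall x, f_ ^~ x @ \oo --> f x} ->
  mu.-integrable setT (EFin \o g) -> (forall n x, `|f_ n x| <= g x) ->
  \int[mu]_x f_ n x @[n --> \oo] --> \int[mu]_x f x.
Proof.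
move=> mf_ mf ff ig fg; apply: fine_cvg.
have [] := @dominated_convergence _ _ _ mu setT measurableT
    (fun n => EFin \o f_ n) (EFin \o f) (EFin \o g).
- by move=> n; exact/measurable_EFinP.
- exact/measurable_EFinP.
- by apply: filterS ff => x fx _; apply: cvg_EFin => //; exact: nearW.
- exact: ig.
- by apply: aeW => x n _; rewrite lee_fin.
move=> ifi _; rewrite /Rintegral fineK//.
exact: integrable_fin_num.
Qed.

(** * Plancherel's inequality for bounded continuous functions *)

Section plancherel_continuous.
Context {R : realType}.
Local Notation mu := (@lebesgue_measure R).

Lemma invSn_cvg0 : (n.+1%:R^-1 : R) @[n --> \oo] --> 0.
Proof. exact: cvg_harmonic. Qed.

(** In the Poisson energy divided by [e], the weight [exp (- e p)] is at most 1, which gives the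
    upper bound. The other side tends to [pi] times the integral of [w ^+ 2] by two dominated
    convergences, where continuity and boundedness of [w] are used. *)
Lemma plancherel_le_continuous (w : R -> R) (M : R) :
  mu.-integrable setT (EFin \o w) -> continuous w -> (forall x, `|w x| <= M) ->
  ((@pi R)%:E * \int[mu]_x (w x ^+ 2)%:E <=
   \int[mu]_(p in `[0%R, +oo[) (cosT w p ^+ 2 + sinT w p ^+ 2)%:E)%E.
Proof.
move=> wi cw wM.
have M0 : 0 <= M by exact: le_trans (wM 0).
have mw := continuous_measurableT cw.
pose e n : R := n.+1%:R^-1.
have e0 n : 0 < e n by rewrite invr_gt0.
have iq := @integrable_oneDsqrV R.
have mq := @measurable_oneDsqrV R.
(* [J n x] is the Poisson mean of [w] at [x], without the factor [1 / pi], after the substitution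
   [y = e n * s + x]. The kernel then no longer depends on [n]. *)
pose J n x := \int[mu]_s (w (e n * s + x) * (oneDsqr s)^-1).
pose B n (z : R * R) := (oneDsqr ((z.1 - z.2) / e n))^-1.
have mB n : measurable_fun setT (B n).
  apply: (measurableT_comp mq); apply: measurable_funM => //.
  exact: measurable_funB.
have B1 n z : `|B n z| <= 1.
  by rewrite /B ger0_norm ?oneDsqrV_ge0//; exact: oneDsqrV_le1.
have ikx n x : mu.-integrable setT (EFin \o (fun y => w y * B n (x, y))).
  exact: integrable_kernel1.
have BE n x s : B n (x, e n * s + x) = (oneDsqr s)^-1.
  rewrite /B /oneDsqr/= opprD addrCA subrr addr0 mulNr sqrrN mulrAC mulfV ?mul1r//.
  by rewrite gt_eqF.
have JE n x : \int[mu]_y (w y * B n (x, y)) = e n * J n x.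
  have -> : J n x = fine (((e n)^-1)%:E * \int[mu]_y (w y * B n (x, y))%:E)%E.
    rewrite -(integral_affine x (e0 n) (ikx n x)); congr fine.
    by apply: eq_integral => s _ /=; rewrite BE.
  rewrite fineM//; last exact: (integrable_fin_num _ (ikx n x)).
  by rewrite mulrA divff ?gt_eqF// mul1r.
have iwJ n : mu.-integrable setT (EFin \o (fun x => w x * J n x)).
  have := integrable_Fubini_kernel wi wi (mB n) (B1 n).
  move=> /(integrableZl measurableT (e n)^-1).
  apply: eq_integrable => //= x _; rewrite JE -EFinM; congr EFin.
  by field; rewrite gt_eqF.
have energyE n : \int[mu]_x (w x * J n x) =
    (e n)^-1 * \int[mu]_p (exponential_pdf (e n) p * (cosT w p ^+ 2 + sinT w p ^+ 2)).
  rewrite (poisson_energy (e0 n) wi).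
  under [in RHS]eq_Rintegral => x _ do rewrite -/(B n (x, _)) JE mulrCA.
  rewrite RintegralZl//; first by rewrite mulKf// gt_eqF.
have Jint n x : mu.-integrable setT (EFin \o (fun s => w (e n * s + x) * (oneDsqr s)^-1)).
  have := integrable_affine x (e0 n) (ikx n x).
  by apply: eq_integrable => //= s _; rewrite BE.
have Jle n x : `|J n x| <= M * pi.
  rewrite (le_trans (le_normr_Rintegral _ (Jint n x)))//.
  have -> : M * pi = \int[mu]_s (M * (oneDsqr s)^-1).
    by rewrite RintegralZl// {1}/Rintegral integralT_oneDsqrV.
  apply: le_Rintegral => //.
  - exact: integrable_norm (Jint n x).
  - exact: (integrableZl _ _ iq).
  - by move=> s _; rewrite normrM [`|_^-1|]ger0_norm ?oneDsqrV_ge0// ler_wpM2r ?oneDsqrV_ge0.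
have Jcvg x : J n x @[n --> \oo] --> w x * pi.
  have -> : w x * pi = \int[mu]_s (w x * (oneDsqr s)^-1).
    by rewrite RintegralZl// {1}/Rintegral integralT_oneDsqrV.
  apply: (@dominated_Rintegral_cvg _ _ _ mu
    (fun n s => w (e n * s + x) * (oneDsqr s)^-1) _ (fun s => M * (oneDsqr s)^-1)).
  - move=> n; apply: measurable_funM => //; apply: measurableT_comp => //.
    exact: measurable_affine.
  - exact: measurable_funM.
  - apply: aeW => s; apply: cvgM; last exact: cvg_cst.
    have : e n * s + x @[n --> \oo] --> 0 * s + x.
      apply: cvgD; last exact: cvg_cst.
      apply: cvgM; [exact: invSn_cvg0|exact: cvg_cst].
    by rewrite mul0r add0r; apply: continuous_cvg; exact: cw.
  - exact: (integrableZl _ _ iq).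
  - by move=> n s; rewrite normrM [`|_^-1|]ger0_norm ?oneDsqrV_ge0// ler_wpM2r ?oneDsqrV_ge0.
have wJcvg : \int[mu]_x (w x * J n x) @[n --> \oo] --> \int[mu]_x (w x * (w x * pi)).
  apply: (@dominated_Rintegral_cvg _ _ _ mu
    (fun n x => w x * J n x) _ (fun x => (M * pi) * `|w x|)).
  - by move=> n; apply/measurable_EFinP; exact: measurable_int (iwJ n).
  - by apply: measurable_funM => //; exact: measurable_funM.
  - by apply: aeW => x; apply: cvgM; [exact: cvg_cst|exact: Jcvg].
  - exact: (integrableZl _ (M * pi) (integrable_norm wi)).
  - by move=> n x; rewrite normrM mulrC ler_wpM2r.
(* Boundedness makes [w] square integrable, since [w ^+ 2] is at most [M] times its absolute
   value. *)
have iw2 : mu.-integrable setT (EFin \o (fun x => w x * w x)).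
  apply: le_integrable (integrableZl measurableT M wi) => //.
    by apply/measurable_EFinP; exact: measurable_funM.
  by move=> x _ /=; rewrite lee_fin !normrM (ger0_norm M0) ler_wpM2r.
have -> : ((@pi R)%:E * \int[mu]_x (w x ^+ 2)%:E =
    (\int[mu]_x (w x * (w x * pi)))%:E)%E.
  under eq_integral do rewrite expr2.
  under eq_Rintegral do rewrite mulrA.
  by rewrite RintegralZr// mulrC EFinM /Rintegral fineK// integrable_fin_num.
have wJE : (\int[mu]_x (w x * J n x))%:E @[n --> \oo] --> (\int[mu]_x (w x * (w x * pi)))%:E.
  by apply: cvg_EFin => //; exact: nearW.
apply: cvge_le wJE.
(* A real integral is the [fine] part of the extended one, so it is 0 when the latter is infinite.
   Only this inequality survives in general, and it goes in the right direction. *)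
have fine_ge0_le (X : \bar R) : (0 <= X -> (fine X)%:E <= X)%E.
  by case: X => //= _; exact: leey.
have mE : measurable_fun setT (fun p => cosT w p ^+ 2 + sinT w p ^+ 2).
  apply: measurable_funD; apply: measurable_funX; apply: continuous_measurableT.
    exact: continuous_cosT.
  exact: continuous_sinT.
apply: nearW => n /=; rewrite energyE EFinM.
have E0 p : 0 <= cosT w p ^+ 2 + sinT w p ^+ 2 by rewrite addr_ge0 ?sqr_ge0.
have pdf0 p : 0 <= exponential_pdf (e n) p by exact: exponential_pdf_ge0 (ltW (e0 n)) p.
have ev0 : 0 <= (e n)^-1 by rewrite invr_ge0 ltW.
have mpE : measurable_fun setT (fun p => exponential_pdf (e n) p * (cosT w p ^+ 2 + sinT w p ^+ 2)).
  by apply: measurable_funM => //; exact: measurable_exponential_pdf.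
apply: (@le_trans _ _ ((e n)^-1%:E *
    \int[mu]_p (exponential_pdf (e n) p * (cosT w p ^+ 2 + sinT w p ^+ 2))%:E)%E).
  apply: lee_pmul => //.
    by rewrite lee_fin Rintegral_ge0// => p _; rewrite mulr_ge0.
  by apply: fine_ge0_le; apply: integral_ge0 => p _; rewrite lee_fin mulr_ge0.
rewrite -ge0_integralZl//; last 2 first.
- exact/measurable_EFinP.
- by move=> p _; rewrite lee_fin mulr_ge0.
rewrite [leRHS]integral_mkcond; apply: ge0_le_integral => //.
- by move=> p _; rewrite -EFinM lee_fin mulr_ge0// mulr_ge0.
- by under eq_fun do rewrite -EFinM; apply/measurable_EFinP; exact: measurable_funM.
- by apply/(measurable_restrictT _ _).1 => //; apply/measurable_EFinP; exact: measurable_funTS.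
move=> p _; rewrite patchE; case: ifPn => [|].
  rewrite inE/= in_itv/= andbT => p0; rewrite -EFinM lee_fin exponential_pdfE// !mulrA mulVf ?gt_eqF// mul1r.
  by rewrite ler_piMl// -expR0 ler_expR mulNr oppr_le0 mulr_ge0 ?(ltW (e0 n)).
rewrite notin_setE/= in_itv/= andbT => /negP; rewrite -ltNge => p0.
by rewrite lt0_exponential_pdf// mul0r mule0.
Qed.

End plancherel_continuous.

(** * Convolution with a bounded integrable kernel *)

Section convolution.
Context {R : realType}.
Local Notation mu := (@lebesgue_measure R).

Definition conv (f kap : R -> R) (x : R) := \int[mu]_y (f y * kap (x - y)).

Lemma Rintegral_shift (g : R -> R) (y : R) : mu.-integrable setT (EFin \o g) ->
  \int[mu]_x g (x - y) = \int[mu]_x g x.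
Proof.
move=> ig; congr fine.
have := integral_affine (- y) ltr01 ig; rewrite invr1 mul1e => <-.
by apply: eq_integral => x _ /=; rewrite mul1r.
Qed.

Lemma integrable_shift (g : R -> R) (y : R) : mu.-integrable setT (EFin \o g) ->
  mu.-integrable setT (EFin \o (fun x => g (x - y))).
Proof.
move=> ig; have := integrable_affine (- y) ltr01 ig.
by apply: eq_integrable => // x _ /=; rewrite mul1r.
Qed.

Variables (f kap : R -> R) (K : R).
Hypotheses (fi : mu.-integrable setT (EFin \o f))
  (ki : mu.-integrable setT (EFin \o kap)) (kK : forall t, `|kap t| <= K).

Let mf : measurable_fun setT f.
Proof. by apply/measurable_EFinP; exact: measurable_int fi. Qed.
Let mk : measurable_fun setT kap.
Proof. by apply/measurable_EFinP; exact: measurable_int ki. Qed.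
Let K0 : 0 <= K. Proof. exact: le_trans (kK 0). Qed.

(** Boundedness of [kap] gives integrability at every [x]; integrability of [kap] alone would give
    it at almost every [x]. *)
Lemma integrable_conv_slice x : mu.-integrable setT (EFin \o (fun y => f y * kap (x - y))).
Proof.
apply: le_integrable (integrableZl measurableT K fi) => //.
  apply/measurable_EFinP/measurable_funM => //; apply: measurableT_comp => //.
  exact: measurable_funB.
by move=> y _ /=; rewrite lee_fin !normrM (ger0_norm K0) mulrC ler_wpM2r.
Qed.

Lemma conv_bounded x : `|conv f kap x| <= K * \int[mu]_y `|f y|.
Proof.
rewrite (le_trans (le_normr_Rintegral _ (integrable_conv_slice x)))//.
rewrite -RintegralZl//; last exact: integrable_norm.
apply: le_Rintegral => //.
- exact: integrable_norm (integrable_conv_slice x).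
- exact: (integrableZl _ K (integrable_norm fi)).
by move=> y _; rewrite normrM mulrC ler_wpM2r.
Qed.

Section against_bounded.
Variable b : R -> R.
Hypotheses (mb : measurable_fun setT b) (b1 : forall x, `|b x| <= 1).

Let F (z : R * R) := (f z.2 * (kap (z.1 - z.2) * b z.1))%:E.

Let mF : measurable_fun setT F.
Proof.
apply/measurable_EFinP; apply: measurable_funM.
  exact: measurableT_comp.
apply: measurable_funM; last exact: measurableT_comp.
by apply: measurableT_comp => //; exact: measurable_funB.
Qed.

Let iy y : mu.-integrable setT (EFin \o (fun x => kap (x - y) * b x)).
Proof. by apply: integrable_bounded_mul => //; exact: integrable_shift. Qed.

Let iF : (mu \x mu)%E.-integrable setT F.
Proof.
apply/integrable21ltyP => //.
apply: (@le_lt_trans _ _ (\int[mu]_y ((\int[mu]_x `|kap x|)%:E * `|f y|%:E))%E).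
  apply: ge0_le_integral => //=.
  - by move=> x _; exact: integral_ge0.
  - apply: (@measurable_fun_fubini_tonelli_G _ _ _ _ _ mu (abse \o F)).
      exact: measurableT_comp.
    by move=> z; exact: abse_ge0.
  - apply: measurable_funeM.
    by apply/measurable_EFinP; exact: measurableT_comp.
  move=> y _.
  have ik := integrable_norm ki.
  have -> : (\int[mu]_x `|kap x|)%:E = (\int[mu]_x `|kap (x - y)|%:E)%E.
    rewrite -(@Rintegral_shift (fun x => `|kap x|) y)// /Rintegral fineK//.
    exact: integrable_fin_num (integrable_shift y ik).
  rewrite muleC -ge0_integralZl//; last first.
    by apply: measurable_int (integrable_shift y ik).
  apply: ge0_le_integral => //=.
  - apply/measurable_EFinP/measurableT_comp => //.
    apply: measurable_funM => //.
    by apply/measurable_EFinP; exact: measurable_int (iy y).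
  - by apply: measurable_funeM; apply: measurable_int (integrable_shift y ik).
  move=> x _; rewrite -EFinM lee_fin !normrM ler_wpM2l//.
  by rewrite -[leRHS]mulr1 ler_wpM2l.
apply: integrable_lty => //.
exact: (integrableZl _ _ (integrable_norm fi)).
Qed.

Let innerE x : (\int[mu]_y F (x, y) = (conv f kap x * b x)%:E)%E.
Proof.
rewrite /F/=; under eq_integral do rewrite mulrA EFinM.
rewrite integralZr//; last exact: integrable_conv_slice.
by rewrite EFinM /conv /Rintegral fineK// integrable_fin_num// integrable_conv_slice.
Qed.

(** The bounded factor [b] lets one integrability argument serve several purposes: [b = 1] gives
    integrability of the convolution, and the cosine and the sine of [x * p] give its transforms. *)
Lemma integrable_conv_mul : mu.-integrable setT (EFin \o (fun x => conv f kap x * b x)).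
Proof.
by apply: eq_integrable (integrable_fubini_F iF) => //= x _; rewrite /fubini_F innerE.
Qed.

Lemma Fubini_conv : \int[mu]_x (conv f kap x * b x) =
  \int[mu]_y (f y * \int[mu]_x (kap (x - y) * b x)).
Proof.
congr fine; transitivity (\int[mu]_x \int[mu]_y F (x, y))%E.
  by apply: eq_integral => x _; rewrite innerE.
rewrite (Fubini iF); apply: eq_integral => y _; rewrite /F/=.
under eq_integral do rewrite EFinM.
rewrite integralZl//; last exact: iy.
by rewrite EFinM /Rintegral fineK//; exact: integrable_fin_num (iy y).
Qed.

End against_bounded.

Lemma integrable_conv : mu.-integrable setT (EFin \o conv f kap).
Proof.
have b1 (x : R) : `|(cst 1 : R -> R) x| <= 1 by rewrite normr1.
have m1 : measurable_fun [set: R] (cst 1 : R -> R) by exact: measurable_cst.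
have := integrable_conv_mul m1 b1.
by apply: eq_integrable => // x _ /=; rewrite mulr1.
Qed.

Let kshift (g : R -> R) y p : measurable_fun setT g -> (forall x, `|g x| <= 1) ->
  \int[mu]_x (kap (x - y) * g (x * p)) = \int[mu]_x (kap x * g (x * p + y * p)).
Proof.
move=> mg g1; rewrite -(@Rintegral_shift (fun x => kap x * g (x * p + y * p)) y).
  by apply: eq_Rintegral => x _; rewrite mulrBl subrK.
apply: integrable_bounded_mul => //.
apply: measurableT_comp => //; apply: measurable_funD => //.
by apply: measurable_funM.
Qed.

(** Together with [sinT_conv], this is the real and imaginary part of the rule that the transform of
    a convolution is the product [(cosT f - i sinT f) (cosT kap - i sinT kap)]. *)
Lemma cosT_conv p : cosT (conv f kap) p = cosT f p * cosT kap p - sinT f p * sinT kap p.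
Proof.
rewrite /cosT Fubini_conv//; last 2 first.
- exact: measurable_cos_lin.
- by move=> x; exact: normr_cos_le1.
rewrite -/(cosT kap p) -/(cosT f p) -RintegralZr//; last exact: integrable_cosT.
rewrite -RintegralZr//; last exact: integrable_sinT.
rewrite -RintegralB//; last 2 first.
- apply: (integrableZr _ _ (integrable_cosT p fi)) => //.
- apply: (integrableZr _ _ (integrable_sinT p fi)) => //.
apply: eq_Rintegral => y _; rewrite -mulrA -mulrA -mulrBr; congr (_ * _).
rewrite (kshift y p); last 2 first.
- exact: continuous_measurableT (@continuous_cos R).
- exact: normr_cos_le1.
rewrite /cosT /sinT -RintegralZl//; last exact: integrable_cosT.
rewrite -RintegralZl//; last exact: integrable_sinT.
rewrite -RintegralB//; last 2 first.
- exact: (integrableZl _ _ (integrable_cosT p ki)).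
- exact: (integrableZl _ _ (integrable_sinT p ki)).
by apply: eq_Rintegral => x _; rewrite cosD; ring.
Qed.

Lemma sinT_conv p : sinT (conv f kap) p = cosT f p * sinT kap p + sinT f p * cosT kap p.
Proof.
rewrite /sinT Fubini_conv//; last 2 first.
- exact: measurable_sin_lin.
- by move=> x; exact: normr_sin_le1.
rewrite -/(sinT kap p) -/(sinT f p) -RintegralZr//; last exact: integrable_cosT.
rewrite -RintegralZr//; last exact: integrable_sinT.
rewrite -RintegralD//; last 2 first.
- apply: (integrableZr _ _ (integrable_cosT p fi)) => //.
- apply: (integrableZr _ _ (integrable_sinT p fi)) => //.
apply: eq_Rintegral => y _; rewrite -mulrA -mulrA -mulrDr; congr (_ * _).
rewrite (kshift y p); last 2 first.
- exact: continuous_measurableT (@continuous_sin R).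
- exact: normr_sin_le1.
rewrite /cosT /sinT -RintegralZl//; last exact: integrable_sinT.
rewrite -RintegralZl//; last exact: integrable_cosT.
rewrite -RintegralD//; last 2 first.
- exact: (integrableZl _ _ (integrable_sinT p ki)).
- exact: (integrableZl _ _ (integrable_cosT p ki)).
by apply: eq_Rintegral => x _; rewrite sinD; ring.
Qed.

End convolution.

Section l1_bound.
Context {R : realType}.
Local Notation mu := (@lebesgue_measure R).

(** A real form of the bound of the transform by the L1 norm. Pairing the vector [(C, S)] with
    itself gives [E] as the integral of [kap x * (C cos (x p) + S sin (x p))]. By Cauchy-Schwarz
    this is at most [Num.sqrt E * I], and one factor [Num.sqrt E] cancels. *)
Lemma energy_le_L1 (kap : R -> R) p : mu.-integrable setT (EFin \o kap) ->
  cosT kap p ^+ 2 + sinT kap p ^+ 2 <= (\int[mu]_x `|kap x|) ^+ 2.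
Proof.
move=> ki; set C := cosT kap p; set S := sinT kap p; set I := \int[mu]_x _.
have I0 : 0 <= I by apply: Rintegral_ge0.
set E := C ^+ 2 + S ^+ 2.
have E0 : 0 <= E by rewrite addr_ge0 ?sqr_ge0.
have le : E <= Num.sqrt E * I.
  rewrite {1}/E !expr2 {1}/C {2}/S /cosT /sinT -RintegralZr//; last exact: integrable_cosT.
  rewrite -RintegralZl//; last exact: integrable_sinT.
  rewrite -RintegralD//; last 2 first.
  - by apply: (integrableZr _ _ (integrable_cosT p ki)).
  - exact: (integrableZl _ _ (integrable_sinT p ki)).
  rewrite -RintegralZl//; last exact: integrable_norm.
  apply: le_Rintegral => //.
  - exact: (integrableD measurableT (integrableZr _ _ (integrable_cosT p ki))
      (integrableZl _ _ (integrable_sinT p ki))).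
  - exact: (integrableZl _ _ (integrable_norm ki)).
  move=> x _.
  have -> : kap x * cos (x * p) * C + S * (kap x * sin (x * p)) =
    kap x * (C * cos (x * p) + S * sin (x * p)) by ring.
  rewrite (le_trans (ler_norm _))// normrM mulrC ler_wpM2r//.
  rewrite -(@ler_pXn2r _ 2)// ?nnegrE// ?sqrtr_ge0// sqr_sqrtr// real_normK ?num_real//.
  rewrite /E -[leRHS]mulr1 -(cos2Dsin2 (x * p)) -subr_ge0.
  by rewrite (_ : _ - _ = (C * sin (x * p) - S * cos (x * p)) ^+ 2) ?sqr_ge0//; ring.
have : Num.sqrt E <= I.
  have [->|sE] := eqVneq (Num.sqrt E) 0; first by [].
  have sE0 : 0 < Num.sqrt E by rewrite lt_def sE sqrtr_ge0.
  by rewrite -(ler_pM2l sE0) -expr2 sqr_sqrtr.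
by move=> h; rewrite -[leLHS]sqr_sqrtr// ler_pXn2r ?nnegrE ?sqrtr_ge0.
Qed.

End l1_bound.

(** * Moving averages and Plancherel's inequality for integrable functions *)

Section plancherel_real.
Context {R : realType}.
Local Notation mu := (@lebesgue_measure R).

(** Convolution with [box r] is the mean over the interval of radius [r]. The normalisation to mass
    1 keeps the modulus of its transform at most 1. *)
Definition box (r : R) (t : R) : R := (2 * r)^-1 * \1_(ball (0 : R) r) t.

Lemma ae_neq (a : R) : {ae mu, forall y, y != a}.
Proof.
exists [set a]; split => //; first exact: lebesgue_measure_set1.
by move=> y /= /negP; rewrite negbK => /eqP.
Qed.

Lemma box_bounded r t : 0 < r -> `|box r t| <= (2 * r)^-1.
Proof.
move=> r0; rewrite /box normrM gtr0_norm ?invr_gt0 ?mulr_gt0//.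
rewrite ler_piMr ?invr_ge0 ?mulr_ge0 ?(ltW r0)//.
by rewrite indicE; case: (_ \in _); rewrite ?normr1 ?normr0.
Qed.

Lemma integrable_box r : 0 < r -> mu.-integrable setT (EFin \o box r).
Proof.
move=> r0.
have iI : mu.-integrable setT (EFin \o (\1_(ball (0 : R) r) : R -> R)).
  by rewrite ball_itv; exact: integrable_indic_itv.
exact: (integrableZl _ (2 * r)^-1 iI).
Qed.

Lemma Rintegral_box r : 0 < r -> \int[mu]_t `|box r t| = 1.
Proof.
move=> r0.
have c0 : 0 < (2 * r)^-1 by rewrite invr_gt0 mulr_gt0.
have b0 t : 0 <= box r t by rewrite mulr_ge0 ?(ltW c0)// indicE.
under eq_Rintegral do rewrite ger0_norm//.
have iI : mu.-integrable setT (EFin \o (\1_(ball (0 : R) r) : R -> R)).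
  by rewrite ball_itv; exact: integrable_indic_itv.
rewrite RintegralZl// /Rintegral integral_indic//; last exact: measurable_ball.
rewrite [X in fine X](_ : _ = (r *+ 2)%:E); last first.
  by rewrite setIT; apply: lebesgue_measure_ball; exact: ltW.
rewrite /= -[r *+ 2]mulr_natl mulVf// gt_eqF//.
by rewrite mulr_gt0.
Qed.

Lemma boxE (r t : R) : box r t = (2 * r)^-1 * (`|t| < r)%R%:R.
Proof.
rewrite /box indicE; congr (_ * _%:R); congr nat_of_bool.
by apply/idP/idP; rewrite inE -ball_normE/= sub0r normrN.
Qed.

Lemma continuous_box (r t : R) : 0 < r -> t != r -> t != - r -> {for t, continuous (box r)}.
Proof.
move=> r0 tr tNr.
have nt : `|s| @[s --> t] --> `|t| by apply: cvg_norm; exact: cvg_id.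
have eqnear : (\forall s \near t, box r t = box r s) -> {for t, continuous (box r)}.
  by move/near_eq_cvg/cvg_trans; apply; exact: cvg_cst.
apply: eqnear; have [lt|ge|eq] := ltgtP `|t| r; last first.
- move: tr tNr; rewrite -eq; case: (ger0P t) => _.
    by rewrite eqxx.
  by rewrite opprK eqxx.
- near=> s; have rs : r < `|s| by near: s; exact: (cvgr_gt _ nt _ ge).
  by rewrite !boxE !ltNge (ltW ge) (ltW rs).
- near=> s; have rs : `|s| < r by near: s; exact: (cvgr_lt _ nt _ lt).
  by rewrite !boxE rs lt.
Unshelve. all: by end_near. Qed.

(** The box jumps only at [r] and [- r]. Along a sequence tending to [x] the integrand therefore
    converges for every [y] other than [x - r] and [x + r], and it is dominated by a multiple of the
    absolute value of [f]. *)
Lemma continuous_conv_box (f : R -> R) r : 0 < r ->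
  mu.-integrable setT (EFin \o f) -> continuous (conv f (box r)).
Proof.
move=> r0 fi x; apply/(@cvg_nbhsP _ R^o) => u ux.
have mf : measurable_fun setT f by apply/measurable_EFinP; exact: measurable_int fi.
have mb : measurable_fun setT (box r).
  by apply/measurable_EFinP; exact: measurable_int (integrable_box r0).
apply: (@dominated_Rintegral_cvg _ _ _ mu
  (fun n y => f y * box r (u n - y)) (fun y => f y * box r (x - y)) (fun y => (2 * r)^-1 * `|f y|)).
- move=> n; apply: measurable_funM => //; apply: measurableT_comp => //.
  exact: measurable_funB.
- apply: measurable_funM => //; apply: measurableT_comp => //.
  exact: measurable_funB.
- apply: (@filterS2 _ _ (ae_filter_ringOfSetsType mu) _ _ _ _ (ae_neq (x - r)) (ae_neq (x + r))) => y yr yNr.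
  apply: cvgM; first exact: cvg_cst.
  apply: continuous_cvg.
    apply: continuous_box => //.
      by apply: contra yr => /eqP <-; apply/eqP; ring.
    by apply: contra yNr => /eqP/(congr1 -%R); rewrite opprK => <-; apply/eqP; ring.
  by apply: cvgB => //; exact: cvg_cst.
- exact: (integrableZl _ _ (integrable_norm fi)).
- by move=> n y; rewrite normrM mulrC ler_wpM2r// box_bounded.
Qed.

(** Lebesgue differentiation: the convolution at [x] is the mean of [f] over the ball of radius
    [1 / (n + 1)] about [x]. *)
Lemma conv_box_cvg (f : R -> R) : mu.-integrable setT (EFin \o f) ->
  {ae mu, forall x, conv f (box n.+1%:R^-1) x @[n --> \oo] --> f x}.
Proof.
move=> fi.
have mf : measurable_fun setT f by apply/measurable_EFinP; exact: measurable_int fi.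
have lf : locally_integrable setT f.
  by apply: open_integrable_locally => //; exact: openT.
apply: (@filterS _ _ (ae_filter_ringOfSetsType mu) _ _ _ (lebesgue_differentiation lf)) => x fx.
have r0 n : 0 < n.+1%:R^-1 :> R by rewrite invr_gt0.
pose E (x : R) n := ball x (n.+1%:R^-1 : R).
have nE y : nicely_shrinking y (E y).
  split; first by move=> n; exact: measurable_ball.
  exists (1, fun n => PosNum (r0 n)); split => //=.
  - exact: invSn_cvg0.
  - by move=> n; rewrite /E.
  - by move=> n; rewrite mul1e.
have := nice_lebesgue_differentiation nE lf fx.
move=> /fine_cvg; apply: cvg_trans; apply: near_eq_cvg; apply: nearW => n /=.
have -> : mu (E x n) = ((n.+1%:R^-1 : R) *+ 2)%:E.
  by apply: lebesgue_measure_ball; exact: ltW.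
rewrite /E.
have -> : (\int[mu]_(y in ball x (n.+1%:R^-1 : R)) (f y)%:E =
    \int[mu]_y (f y * \1_(ball x (n.+1%:R^-1 : R)) y)%:E)%E.
  rewrite integral_mkcond; apply: eq_integral => y _.
  by rewrite patchE indicE; case: (_ \in _); rewrite ?mulr1 ?mulr0.
set r : R := n.+1%:R^-1.
have r2 : 0 < r *+ 2 by rewrite pmulrn_lgt0 ?(r0 n).
have mb : measurable_fun setT (\1_(ball x r) : R -> R).
  by apply: measurable_indic; exact: measurable_ball.
have b1 y : `|(\1_(ball x r) : R -> R) y| <= 1.
  by rewrite indicE; case: (_ \in _); rewrite ?normr1 ?normr0.
have ib := integrable_bounded_mul fi mb b1.
rewrite inver gt_eqF// fineM//; last exact: integrable_fin_num ib.
transitivity (\int[mu]_y ((r *+ 2)^-1 * (f y * \1_(ball x r) y))).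
  by rewrite RintegralZl.
apply: eq_Rintegral => y _; rewrite mulrCA; congr (_ * _).
rewrite /box [2 * r]mulr_natl; congr (_ * _); rewrite !indicE; congr (nat_of_bool _)%:R.
by apply/idP/idP; rewrite !inE -ball_normE/= sub0r normrN.
Qed.

(* The half-line suffices since [cosT f ^+ 2 + sinT f ^+ 2] is even. *)
Lemma plancherel_le (f : R -> R) : mu.-integrable setT (EFin \o f) ->
  ((@pi R)%:E * \int[mu]_x (f x ^+ 2)%:E <=
   \int[mu]_(p in `[0%R, +oo[) (cosT f p ^+ 2 + sinT f p ^+ 2)%:E)%E.
Proof.
move=> fi.
have mf : measurable_fun setT f by apply/measurable_EFinP; exact: measurable_int fi.
have mE (w : R -> R) : mu.-integrable setT (EFin \o w) ->
    measurable_fun (`[0%R, +oo[ : set R) (fun p => (cosT w p ^+ 2 + sinT w p ^+ 2)%:E).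
  move=> wi; apply/measurable_EFinP; apply: measurable_funTS.
  apply: measurable_funD; apply: measurable_funX; apply: continuous_measurableT.
    exact: continuous_cosT.
  exact: continuous_sinT.
pose r n : R := n.+1%:R^-1.
have r0 n : 0 < r n by rewrite invr_gt0.
pose w n := conv f (box (r n)).
have wi n : mu.-integrable setT (EFin \o w n).
  exact: integrable_conv fi (integrable_box (r0 n)) (fun t => box_bounded t (r0 n)).
have mw n : measurable_fun setT (w n) by apply/measurable_EFinP; exact: measurable_int (wi n).
set Z := (\int[mu]_(p in `[0%R, +oo[) (cosT f p ^+ 2 + sinT f p ^+ 2)%:E)%E.
have wle n : ((@pi R)%:E * \int[mu]_x (w n x ^+ 2)%:E <= Z)%E.
  apply: (le_trans (plancherel_le_continuous (wi n) (continuous_conv_box (r0 n) fi)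
    (conv_bounded fi (integrable_box (r0 n)) (fun t => box_bounded t (r0 n))))).
  rewrite /Z; apply: ge0_le_integral => //.
  - by move=> p _; rewrite lee_fin addr_ge0 ?sqr_ge0.
  - exact: mE.
  - exact: mE.
  move=> p _; rewrite lee_fin.
  rewrite (cosT_conv fi (integrable_box (r0 n)) (fun t => box_bounded t (r0 n))).
  rewrite (sinT_conv fi (integrable_box (r0 n)) (fun t => box_bounded t (r0 n))).
  have := energy_le_L1 p (integrable_box (r0 n)).
  rewrite Rintegral_box// expr1n => e1.
  (* The squared modulus of a product of transforms is the product of the squared moduli, and that
     of the box is at most 1 by [e1]. *)
  rewrite [leLHS](_ : _ = (cosT f p ^+ 2 + sinT f p ^+ 2) *
    (cosT (box (r n)) p ^+ 2 + sinT (box (r n)) p ^+ 2)); last by ring.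
  by rewrite ler_piMr// addr_ge0 ?sqr_ge0.
rewrite -ge0_integralZl//; last 3 first.
- by apply/measurable_EFinP; exact: measurable_funX.
- by move=> x _; rewrite lee_fin sqr_ge0.
- by rewrite lee_fin pi_ge0.
(* Fatou's lemma is used because [f ^+ 2] is not known to be integrable; the bound [Z] may be
   infinite. *)
apply: (@fatou_cvg _ _ _ mu setT (fun n x => (@pi R)%:E * (w n x ^+ 2)%:E)%E _ (fun=> Z)) => //.
- by move=> n; apply: measurable_funeM; apply/measurable_EFinP; apply: measurable_funX; exact: mw.
- by apply: measurable_funeM; apply/measurable_EFinP; exact: measurable_funX.
- by move=> n x _; rewrite mule_ge0// lee_fin ?pi_ge0 ?sqr_ge0.
- apply: (@filterS _ _ (ae_filter_ringOfSetsType mu) _ _ _ (conv_box_cvg fi)) => x wfx _.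
  have wf2 : w n x ^+ 2 @[n --> \oo] --> f x ^+ 2.
    by under eq_fun do rewrite expr2; apply: cvgM.
  apply: cvgeZl => //; apply: cvg_EFin => //; exact: nearW.
- move=> n; rewrite ge0_integralZl//.
  + by apply/measurable_EFinP; apply: measurable_funX; exact: mw.
  + by move=> x _; rewrite lee_fin sqr_ge0.
  + by rewrite lee_fin pi_ge0.
- exact: cvg_cst.
Qed.

End plancherel_real.

(** * Complex-valued functions *)

Section complex_plancherel.
Context {R : realType}.
Local Notation mu := (@lebesgue_measure R).
Local Notation Re := (@complex.Re R).
Local Notation Im := (@complex.Im R).

(** The squared modulus as a polynomial in the two components: identities reduce to [ring] and no
    square root appears. *)
Definition sqn (z : R[i]) : R := Re z ^+ 2 + Im z ^+ 2.

Lemma sqn_ge0 z : 0 <= sqn z.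
Proof. by rewrite addr_ge0 ?sqr_ge0. Qed.

Lemma normc_sqr z : ComplexField.Normc.normc z ^+ 2 = sqn z.
Proof. by case: z => a b; rewrite /= sqr_sqrtr// addr_ge0 ?sqr_ge0. Qed.

Lemma sqnM z w : sqn (z * w) = sqn z * sqn w.
Proof. by case: z w => [a b] [c d]; rewrite /sqn/=; ring. Qed.

Lemma sqnD_le z w : sqn (z + w) <= 2 * sqn z + 2 * sqn w.
Proof.
case: z w => [a b] [c d]; rewrite /sqn/= -subr_ge0.
rewrite (_ : _ - _ = (a - c) ^+ 2 + (b - d) ^+ 2); last by ring.
by rewrite addr_ge0 ?sqr_ge0.
Qed.

Lemma sqnN z : sqn (- z) = sqn z.
Proof. by case: z => [a b]; rewrite /sqn/=; ring. Qed.

Lemma sqn_expi t : sqn (expi t) = 1.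
Proof. by rewrite /sqn/= cos2Dsin2. Qed.

Lemma expiD (s t : R) : expi (s + t) = expi s * expi t.
Proof.
rewrite /expi cosD sinD; apply/eqP; rewrite eq_complex/=.
by rewrite eqxx/= addrC.
Qed.

Lemma ReM (z w : R[i]) : Re (z * w) = Re z * Re w - Im z * Im w.
Proof. by case: z w => [a b] [c d]. Qed.
Lemma ImM (z w : R[i]) : Im (z * w) = Re z * Im w + Im z * Re w.
Proof. by case: z w => [a b] [c d]. Qed.
Lemma ReB (z w : R[i]) : Re (z - w) = Re z - Re w.
Proof. by case: z w => [a b] [c d]. Qed.
Lemma ImB (z w : R[i]) : Im (z - w) = Im z - Im w.
Proof. by case: z w => [a b] [c d]. Qed.

Definition Cmeasurable (f : R -> R[i]) :=
  measurable_fun setT (fun x => Re (f x)) /\ measurable_fun setT (fun x => Im (f x)).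

Definition Cintegrable (f : R -> R[i]) :=
  mu.-integrable setT (EFin \o (fun x => Re (f x))) /\
  mu.-integrable setT (EFin \o (fun x => Im (f x))).

Lemma Cintegrable_measurable f : Cintegrable f -> Cmeasurable f.
Proof.
by move=> [fr fi]; split; apply/measurable_EFinP; [exact: measurable_int fr|
  exact: measurable_int fi].
Qed.

Lemma CLfun1_integrable f : CLfun 1%E f -> Cintegrable f.
Proof. by move=> [/Lfun1_integrable fr /Lfun1_integrable fi]. Qed.

Lemma CLfun_measurable p f : CLfun p f -> Cmeasurable f.
Proof.
by move=> [fr fi]; split; [have := sub_Lfun_mfun fr|have := sub_Lfun_mfun fi];
  rewrite inE.
Qed.

Lemma CmeasurableB f g : Cmeasurable f -> Cmeasurable g ->
  Cmeasurable (fun x => f x - g x).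
Proof.
move=> [fr fi] [gr gi]; split.
  by under eq_fun do rewrite ReB; exact: measurable_funB.
by under eq_fun do rewrite ImB; exact: measurable_funB.
Qed.

Lemma CmeasurableM f g : Cmeasurable f -> Cmeasurable g ->
  Cmeasurable (fun x => f x * g x).
Proof.
move=> [fr fi] [gr gi]; split.
  by under eq_fun do rewrite ReM; apply: measurable_funB; exact: measurable_funM.
by under eq_fun do rewrite ImM; apply: measurable_funD; exact: measurable_funM.
Qed.

Lemma Cmeasurable_cst (z : R[i]) : Cmeasurable (fun=> z).
Proof. by split; exact: measurable_cst. Qed.

Lemma Cmeasurable_comp f (phi : R -> R) : measurable_fun setT phi ->
  Cmeasurable f -> Cmeasurable (fun x => f (phi x)).
Proof. by move=> mphi [fr fi]; split; [exact: (measurableT_comp fr)|exact: (measurableT_comp fi)]. Qed.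

Lemma Cmeasurable_expi : Cmeasurable (@expi R).
Proof.
split; apply: continuous_measurableT => /=; [exact: continuous_cos|exact: continuous_sin].
Qed.

Lemma measurable_sqn f : Cmeasurable f -> measurable_fun setT (fun x => (sqn (f x))%:E).
Proof.
by move=> [fr fi]; apply/measurable_EFinP; apply: measurable_funD; exact: measurable_funX.
Qed.

Lemma CintegrableB f g : Cintegrable f -> Cintegrable g ->
  Cintegrable (fun x => f x - g x).
Proof.
move=> [fr fi] [gr gi]; split.
  apply: eq_integrable (integrableB measurableT fr gr) => //= x _.
  by rewrite ReB.
apply: eq_integrable (integrableB measurableT fi gi) => //= x _.
by rewrite ImB.
Qed.

Lemma CintegrableZr f (c : R[i]) : Cintegrable f -> Cintegrable (fun x => f x * c).
Proof.
move=> [fr fi]; split.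
  apply: eq_integrable (integrableB measurableT (integrableZl measurableT (Re c) fr)
    (integrableZl measurableT (Im c) fi)) => //= x _.
  by rewrite ReM; congr EFin; ring.
apply: eq_integrable (integrableD measurableT (integrableZl measurableT (Im c) fr)
    (integrableZl measurableT (Re c) fi)) => //= x _.
by rewrite ImM; congr EFin; ring.
Qed.

Lemma Cintegrable_expi f (phi : R -> R) : measurable_fun setT phi ->
  Cintegrable f -> Cintegrable (fun x => f x * expi (phi x)).
Proof.
move=> mphi [fr fi].
have mc : measurable_fun setT (fun x => cos (phi x)).
  by apply: measurableT_comp mphi; apply: continuous_measurableT; exact: continuous_cos.
have ms : measurable_fun setT (fun x => sin (phi x)).
  by apply: measurableT_comp mphi; apply: continuous_measurableT; exact: continuous_sin.
have c1 x := normr_cos_le1 (phi x).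
have s1 x := normr_sin_le1 (phi x).
split.
  apply: eq_integrable (integrableB measurableT (integrable_bounded_mul fr mc c1)
    (integrable_bounded_mul fi ms s1)) => //= x _.
  by rewrite ReM.
apply: eq_integrable (integrableD measurableT (integrable_bounded_mul fr ms s1)
    (integrable_bounded_mul fi mc c1)) => //= x _.
by rewrite ImM.
Qed.

Lemma CintegralB f g : Cintegrable f -> Cintegrable g ->
  Cintegral (fun x => f x - g x) = Cintegral f - Cintegral g.
Proof.
move=> [fr fi] [gr gi]; apply/eqP; rewrite eq_complex; apply/andP; split; apply/eqP => /=.
  by under eq_Rintegral do rewrite ReB; rewrite RintegralB.
by under eq_Rintegral do rewrite ImB; rewrite RintegralB.
Qed.

Lemma CintegralZr f (c : R[i]) : Cintegrable f ->
  Cintegral (fun x => f x * c) = Cintegral f * c.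
Proof.
move=> [fr fi]; apply/eqP; rewrite eq_complex ReM ImM; apply/andP; split; apply/eqP => /=.
  under eq_Rintegral do rewrite ReM.
  rewrite RintegralB//; last 2 first.
  - exact: (integrableZr measurableT _ fr).
  - exact: (integrableZr measurableT _ fi).
  by rewrite !RintegralZr.
under eq_Rintegral do rewrite ImM.
rewrite RintegralD//; last 2 first.
- exact: (integrableZr measurableT _ fr).
- exact: (integrableZr measurableT _ fi).
by rewrite !RintegralZr.
Qed.

Lemma fourierL1E f p : Cintegrable f -> fourierL1 f p =
  (cosT (fun x => Re (f x)) p + sinT (fun x => Im (f x)) p) +i*
  (cosT (fun x => Im (f x)) p - sinT (fun x => Re (f x)) p).
Proof.
move=> [fr fi]; apply/eqP; rewrite eq_complex; apply/andP; split; apply/eqP => /=.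
  rewrite -RintegralD//; [|exact: integrable_cosT|exact: integrable_sinT].
  by apply: eq_Rintegral => x _; rewrite ReM/= cosN sinN; ring.
rewrite -RintegralB//; [|exact: integrable_cosT|exact: integrable_sinT].
by apply: eq_Rintegral => x _; rewrite ImM/= cosN sinN; ring.
Qed.

Lemma Cmeasurable_fourierL1 f : Cintegrable f -> Cmeasurable (fourierL1 f).
Proof.
move=> ff; have [fr fi] := ff; split.
  under eq_fun do rewrite fourierL1E//=.
  apply: measurable_funD; apply: continuous_measurableT.
    exact: continuous_cosT.
  exact: continuous_sinT.
under eq_fun do rewrite fourierL1E//=.
apply: measurable_funB; apply: continuous_measurableT.
  exact: continuous_cosT.
exact: continuous_sinT.
Qed.

Lemma cosTN (f : R -> R) p : cosT f (- p) = cosT f p.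
Proof. by apply: eq_Rintegral => x _; rewrite mulrN cosN. Qed.

Lemma sinTN (f : R -> R) p : mu.-integrable setT (EFin \o f) ->
  sinT f (- p) = - sinT f p.
Proof.
move=> fi; rewrite -[RHS]mulN1r /sinT -RintegralZl//; last exact: integrable_sinT.
by apply: eq_Rintegral => x _; rewrite mulrN sinN; ring.
Qed.

Lemma ge0_integral_even_part (h : R -> \bar R) : measurable_fun setT h ->
  (forall p, 0 <= h p)%E ->
  (\int[mu]_p h p = \int[mu]_(p in `[0%R, +oo[) (h p + h (- p)%R))%E.
Proof.
move=> mh h0.
have mhN : measurable_fun setT (fun p : R => h (- p)).
  exact: measurableT_comp.
rewrite ge0_integralD//; last 2 first.
- exact: measurable_funTS.
- exact: measurable_funTS.
rewrite (@ge0_integration_by_substitution0 _ (fun p => h (- p)))//.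
under [X in (_ + X)%E]eq_integral do rewrite opprK.
rewrite -integral_itv_bndo_bndc; last exact: measurable_funTS.
rewrite -ge0_integral_setU//=.
- congr (integral _ _ _); apply/seteqP; split => // x _ /=; rewrite !in_itv/= andbT.
  by case: (leP 0 x); [left|right].
- exact: measurable_funTS.
- apply/disj_setPS => x /= []; rewrite !in_itv/= andbT => x0.
  by rewrite ltNge x0.
Qed.

(** Adding the values at [p] and [- p] cancels the cross terms between [Re f] and [Im f] and leaves
    twice the sum of the two real energies. This factor 2 turns the [pi] of the half-line inequality
    into [2 * pi]. *)
Lemma plancherelC_le (f : R -> R[i]) : Cintegrable f ->
  ((2 * @pi R)%:E * \int[mu]_x (sqn (f x))%:E <= \int[mu]_p (sqn (fourierL1 f p))%:E)%E.
Proof.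
move=> ff; have [fr fi] := ff; have [mr mi] := Cintegrable_measurable ff.
rewrite [leRHS]ge0_integral_even_part; last 2 first.
- by apply: measurable_sqn; exact: Cmeasurable_fourierL1.
- by move=> p; rewrite lee_fin sqn_ge0.
pose Q (g : R -> R) p := cosT g p ^+ 2 + sinT g p ^+ 2.
have Q0 g p : 0 <= Q g p by rewrite addr_ge0 ?sqr_ge0.
have mQ g : mu.-integrable setT (EFin \o g) -> measurable_fun (`[0%R, +oo[ : set R) (EFin \o Q g).
  move=> gi; apply/measurable_EFinP; apply: measurable_funTS.
  apply: measurable_funD; apply: measurable_funX; apply: continuous_measurableT.
    exact: continuous_cosT.
  exact: continuous_sinT.
have -> : (\int[mu]_(p in `[0%R, +oo[) ((sqn (fourierL1 f p))%:E + (sqn (fourierL1 f (- p)))%:E) =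
    \int[mu]_(p in `[0%R, +oo[) (2%:E * ((Q (Re \o f) p)%:E + (Q (Im \o f) p)%:E)))%E.
  apply: eq_integral => p _; rewrite -!EFinD -EFinM; congr EFin.
  by rewrite !fourierL1E// /sqn/= !cosTN !sinTN// /Q; ring.
have mr2 : measurable_fun setT (fun x => (Re (f x) ^+ 2)%:E).
  by apply/measurable_EFinP; exact: measurable_funX.
have mi2 : measurable_fun setT (fun x => (Im (f x) ^+ 2)%:E).
  by apply/measurable_EFinP; exact: measurable_funX.
rewrite ge0_integralZl//; last 2 first.
- by apply: emeasurable_funD; exact: mQ.
- by move=> p _; rewrite -EFinD lee_fin addr_ge0.
rewrite ge0_integralD//; [|by move=> p _; rewrite lee_fin|exact: mQ|
  by move=> p _; rewrite lee_fin|exact: mQ].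
under eq_integral do rewrite EFinD.
rewrite (ge0_integralD mu measurableT _ mr2 _ mi2); last 2 first.
- by move=> x _; rewrite lee_fin sqr_ge0.
- by move=> x _; rewrite lee_fin sqr_ge0.
rewrite EFinM -muleA; apply: lee_pmul => //.
- rewrite mule_ge0 ?lee_fin ?pi_ge0// adde_ge0// integral_ge0// => x _; by rewrite lee_fin sqr_ge0.
- rewrite ge0_muleDr; [|by apply: integral_ge0 => x _; rewrite lee_fin sqr_ge0|
    by apply: integral_ge0 => x _; rewrite lee_fin sqr_ge0].
  by apply: leeD; exact: plancherel_le.
Qed.

End complex_plancherel.

(** * Finite differences of the transform *)

Section multiplier.
Context {R : realType}.
Local Notation mu := (@lebesgue_measure R).

Lemma CLnorm2_sqr (f : R -> R[i]) :
  (CLnorm 2%:E f ^+ 2 = \int[mu]_x (sqn (f x))%:E)%E.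
Proof.
have -> : (\int[mu]_x (sqn (f x))%:E =
    \int[mu]_x (`|(ComplexField.Normc.normc (f x))%:E| `^ 2))%E.
  apply: eq_integral => x _.
  by rewrite abse_EFin poweR_EFin powR_mulrn// real_normK ?num_real// normc_sqr.
rewrite /CLnorm unlock poweR12_sqrt ?sqr_sqrte//;
  by apply: integral_ge0 => x _; exact: poweR_ge0.
Qed.

Lemma CLnorm2_cvg0 (f : nat -> R -> R[i]) :
  CLnorm 2%:E (f n) @[n --> \oo] --> 0%E ->
  (\int[mu]_x (sqn (f n x))%:E)%E @[n --> \oo] --> 0%E.
Proof.
move=> f0; under eq_fun do rewrite -CLnorm2_sqr expe2.
by rewrite -(mule0 0%E); apply: cvgeM.
Qed.

(** Multiplication by [expi (h * x)] translates the transform by [h]. The constant phase comes from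
    centring at [x0]. *)
Lemma fourierL1_modulation (f : R -> R[i]) (h x0 p : R) : Cintegrable f ->
  fourierL1 (fun x => f x * (expi (h * (x - x0)) - 1)) p =
  expi (- (h * x0)) * fourierL1 f (p - h) - fourierL1 f p.
Proof.
move=> fi.
have fs q : Cintegrable (fun x => f x * expi (- (x * q))).
  apply: Cintegrable_expi => //; apply: measurableT_comp => //.
  exact: measurable_funM.
rewrite /fourierL1 mulrC -CintegralZr// -CintegralB//; last exact: CintegrableZr.
congr Cintegral; apply/funext => x.
rewrite -[in RHS]mulrA -expiD.
rewrite (_ : - (x * (p - h)) - h * x0 = h * (x - x0) + - (x * p)); last by ring.
by rewrite expiD; ring.
Qed.

Lemma Cintegrable_modulation (f : R -> R[i]) (h x0 : R) : Cintegrable f ->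
  Cintegrable (fun x => f x * (expi (h * (x - x0)) - 1)).
Proof.
move=> fi; under eq_fun do rewrite mulrBr mulr1.
apply: CintegrableB => //; apply: Cintegrable_expi => //.
by apply: measurable_funM => //; exact: measurable_funB.
Qed.

Lemma sqnB_le z w : @sqn R (z - w) <= 2 * sqn z + 2 * sqn w.
Proof. by rewrite -[sqn w]sqnN; exact: sqnD_le. Qed.

Lemma integral_sqn_le (f g k : R -> R[i]) (a b : R) :
  0 <= a -> 0 <= b -> Cmeasurable f -> Cmeasurable g -> Cmeasurable k ->
  (forall x, sqn (f x) <= a * sqn (g x) + b * sqn (k x)) ->
  (\int[mu]_x (sqn (f x))%:E <=
   a%:E * \int[mu]_x (sqn (g x))%:E + b%:E * \int[mu]_x (sqn (k x))%:E)%E.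
Proof.
move=> a0 b0 mf mg mk le.
have s0 (u : R -> R[i]) x : (0 <= (sqn (u x))%:E)%E by rewrite lee_fin sqn_ge0.
rewrite -!ge0_integralZl//; try exact: measurable_sqn.
rewrite -ge0_integralD//; last 4 first.
- by move=> x _; rewrite mule_ge0.
- by apply: measurable_funeM; exact: measurable_sqn.
- by move=> x _; rewrite mule_ge0.
- by apply: measurable_funeM; exact: measurable_sqn.
apply: ge0_le_integral => //.
- exact: measurable_sqn.
- by apply: emeasurable_funD; apply: measurable_funeM; exact: measurable_sqn.
by move=> x _; rewrite -!EFinM -EFinD lee_fin.
Qed.

Lemma integral_sqn_shift (f : R -> R[i]) (h : R) : Cmeasurable f ->
  (\int[mu]_x (sqn (f (x - h)%R))%:E = \int[mu]_x (sqn (f x))%:E)%E.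
Proof.
move=> mf; have := ge0_integral_affine (- h) ltr01 (measurable_sqn mf).
rewrite invr1 mul1e => <-; last by move=> x; rewrite lee_fin sqn_ge0.
by apply: eq_integral => x _; rewrite mul1r.
Qed.

(* The cost of using [|a + b|^2 <= 2 |a|^2 + 2 |b|^2] twice is a factor [4], which
   is absorbed by the constant [2 pi >= 4] of [plancherelC_le]. *)
Lemma fourierL2_modulation_le (f g : R -> R[i]) (h x0 : R) : is_fourierL2 f g ->
  (\int[mu]_x (sqn (f x * (expi (h * (x - x0)) - 1))%R)%:E <=
   \int[mu]_p (sqn (expi (- (h * x0)) * g (p - h) - g p)%R)%:E)%E.
Proof.
move=> [/CLfun_measurable mf /CLfun_measurable mg [u [uL]]].
move=> /CLnorm2_cvg0 uf /CLnorm2_cvg0 ug.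
have ui n : Cintegrable (u n) by have [/CLfun1_integrable] := uL n.
have mu_ n := Cintegrable_measurable (ui n).
pose th x := expi (h * (x - x0)) - 1.
have mth : Cmeasurable th.
  apply: CmeasurableB; last exact: Cmeasurable_cst.
  apply: (Cmeasurable_comp _ Cmeasurable_expi).
  by apply: measurable_funM => //; exact: measurable_funB.
have th4 x : sqn (th x) <= 4.
  rewrite (le_trans (sqnB_le _ _))// sqn_expi /sqn/=; lra.
pose E p := expi (- (h * x0)) * g (p - h) - g p.
have msh (k : R -> R[i]) : Cmeasurable k -> Cmeasurable (fun p => k (p - h)).
  by move=> mk; apply: (Cmeasurable_comp _ mk); exact: measurable_funB.
have mE : Cmeasurable E.
  by apply: CmeasurableB => //; apply: CmeasurableM; [exact: Cmeasurable_cst|exact: msh].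
pose D n x := u n x * th x.
have Di n : Cintegrable (D n) by exact: Cintegrable_modulation.
have mD n := Cintegrable_measurable (Di n).
pose A n := (\int[mu]_x (sqn (u n x - f x))%:E)%E.
pose B n := (\int[mu]_p (sqn (fourierL1 (u n) p - g p))%:E)%E.
set Z := (\int[mu]_p (sqn (expi _ * _ - _))%:E)%E.
have s0 (k : R -> R[i]) x : (0 <= (sqn (k x))%:E)%E by rewrite lee_fin sqn_ge0.
have I0 (k : R -> R[i]) : (0 <= \int[mu]_x (sqn (k x))%:E)%E by exact: integral_ge0.
have Z0 : (0 <= Z)%E by exact: I0.
have B0 n : (0 <= B n)%E by exact: I0.
(* The constant 8 is [2 * 4], with 4 the bound [th4] on the squared modulus of the multiplier. *)
have step1 n : (\int[mu]_x (sqn (f x * th x))%:E <=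
    2%:E * \int[mu]_x (sqn (D n x))%:E + 8%:E * A n)%E.
  apply: integral_sqn_le => //.
  - exact: CmeasurableM.
  - exact: CmeasurableB.
  move=> x; rewrite (_ : f x * th x = D n x - (u n x - f x) * th x); last by rewrite /D; ring.
  rewrite (le_trans (sqnB_le _ _))// lerD2l sqnM mulrCA mulrC.
  have := sqn_ge0 (u n x - f x); have := th4 x; nra.
have step2 n : (4%:E * \int[mu]_x (sqn (D n x))%:E <= \int[mu]_p (sqn (fourierL1 (D n) p))%:E)%E.
  apply: le_trans (plancherelC_le (Di n)); apply: lee_wpmul2r => //.
  by rewrite lee_fin; have := @pi_ge2 R; lra.
(* The transform of [D n] is [E] plus the same finite difference of the error [fourierL1 (u n) - g].
   By translation invariance the squared norm of the latter is at most [4 * B n], hence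
   [8 = 2 * 4]. *)
have step3 n : (\int[mu]_p (sqn (fourierL1 (D n) p))%:E <= 2%:E * Z + 8%:E * B n)%E.
  have mdel : Cmeasurable (fun p => fourierL1 (u n) p - g p).
    by apply: CmeasurableB => //; exact: Cmeasurable_fourierL1.
  apply: (@le_trans _ _ (2%:E * Z + 2%:E * \int[mu]_p (sqn (expi (- (h * x0)) *
      (fourierL1 (u n) (p - h) - g (p - h)) - (fourierL1 (u n) p - g p)))%:E)%E).
    apply: integral_sqn_le => //.
    - exact: Cmeasurable_fourierL1.
    - apply: CmeasurableB => //; apply: CmeasurableM; first exact: Cmeasurable_cst.
      exact: (msh _ mdel).
    move=> p; rewrite fourierL1_modulation//.
    rewrite [X in sqn X](_ : _ = E p + (expi (- (h * x0)) *
      (fourierL1 (u n) (p - h) - g (p - h)) - (fourierL1 (u n) p - g p))).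
      exact: sqnD_le.
    by rewrite /E; ring.
  rewrite leeD2l// (_ : 8%:E = 2%:E * 4%:E :> \bar R)%E; last by rewrite -EFinM; congr EFin; ring.
  rewrite -muleA; apply: lee_wpmul2l => //.
  rewrite (_ : 4%:E * B n = 2%:E *
      \int[mu]_p (sqn (fourierL1 (u n) (p - h)%R - g (p - h)%R))%:E + 2%:E * B n)%E.
    apply: integral_sqn_le => //.
    - apply: CmeasurableB => //; apply: CmeasurableM; first exact: Cmeasurable_cst.
      exact: (msh _ mdel).
    - exact: (msh _ mdel).
    - move=> p; rewrite (le_trans (sqnB_le _ _))// sqnM sqn_expi mul1r//.
  rewrite (@integral_sqn_shift (fun p => fourierL1 (u n) p - g p))// -ge0_muleDl//.
  by rewrite -EFinD; congr (_%:E * _)%E; ring.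
have fin n : (\int[mu]_x (sqn (f x * th x))%:E <= Z + (4%:E * B n + 8%:E * A n))%E.
  rewrite (le_trans (step1 n))// addeA leeD2r//.
  (* Doubling produces exactly the [4] times the integral of [sqn (D n x)] that [step2] controls.
     The resulting bound is [2 * (Z + 4 * B n)], so [Z] ends with coefficient 1. *)
  rewrite -(@lee_pmul2l _ 2%:E)// muleA -EFinM (_ : 2 * 2 = 4 :> R); last by ring.
  rewrite (le_trans (step2 n))// (le_trans (step3 n))//.
  rewrite (@ge0_muleDr _ 2%:E Z (4%:E * B n))%E ?mule_ge0// muleA -EFinM.
  by rewrite (_ : 2 * 4 = 8 :> R)//; ring.
have lim : (Z + (4%:E * B n + 8%:E * A n))%E @[n --> \oo] --> (Z + (4%:E * 0 + 8%:E * 0))%E.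
  apply: cvgeD; first by rewrite !mule0 adde0 fin_num_adde_defl.
    exact: cvg_cst.
  by apply: cvgeD; [rewrite !mule0|exact: cvgeZl|exact: cvgeZl].
rewrite !mule0 !adde0 in lim.
apply: (cvge_ge _ lim); apply: nearW => n; exact: fin.
Qed.

End multiplier.

(** * Differentiation of the transform *)

Section weighted_bound.
Context {R : realType}.
Local Notation mu := (@lebesgue_measure R).

Lemma diffq_cvg (g : R -> R) (x : R) (u : nat -> R) : derivable g x 1 ->
  (forall n, u n != 0) -> u @ \oo --> 0 ->
  (g (x + u n) - g x) / u n @[n --> \oo] --> derive1 g x.
Proof.
move=> dg u0 ucvg.
have : (fun h : R => h^-1 *: (g (h *: 1 + x) - g x)) @ 0^' --> derive1 g x.
  by rewrite derive1E; exact: dg.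
move=> /cvgr_dnbhsP/(_ u (conj u0 ucvg)); apply: cvg_trans.
apply: near_eq_cvg; apply: nearW => n /=.
by rewrite /GRing.scale/= mulr1 mulrC (addrC x).
Qed.

(** The curve [expi (t * y)] has velocity [(0, y)] at [t = 0]; the limit is the squared length of
    this velocity. *)
Lemma sqn_expiB1_cvg (y : R) (h : nat -> R) : (forall n, h n != 0) ->
  h @ \oo --> 0 ->
  (h n)^-1 ^+ 2 * sqn (expi (h n * y) - 1) @[n --> \oo] --> y ^+ 2.
Proof.
move=> h0 hcvg.
have dc : is_derive (0 : R) (1 : R) (fun t => cos (t * y)) 0.
  by apply: is_derive_eq; rewrite /GRing.scale/= mul0r sin0; ring.
have ds : is_derive (0 : R) (1 : R) (fun t => sin (t * y)) y.
  by apply: is_derive_eq; rewrite /GRing.scale/= mul0r cos0; ring.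
have cc := diffq_cvg (@ex_derive _ _ _ _ _ _ _ dc) h0 hcvg.
have sc := diffq_cvg (@ex_derive _ _ _ _ _ _ _ ds) h0 hcvg.
rewrite derive1E (@derive_val _ _ _ _ _ _ _ dc) in cc.
rewrite derive1E (@derive_val _ _ _ _ _ _ _ ds) in sc.
have -> : y ^+ 2 = 0 * 0 + y * y by rewrite mul0r add0r expr2.
apply: cvg_trans (cvgD (cvgM cc cc) (cvgM sc sc)).
apply: near_eq_cvg; apply: nearW => n /=.
by rewrite !fctE/= add0r mul0r cos0 sin0 /sqn/=; field.
Qed.

(** Finiteness of the weighted integral is part of what is to be obtained, so there is no dominating
    function at hand and the passage to the limit relies on Fatou's lemma. *)
Lemma fourierL2_weighted_le (f g : R -> R[i]) (x0 : R) (h : nat -> R) (K : \bar R) :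
  is_fourierL2 f g -> (forall n, h n != 0) -> h @ \oo --> 0 ->
  (((h n)^-1 ^+ 2)%:E *
    \int[mu]_p (sqn (expi (- (h n * x0)) * g (p - h n) - g p)%R)%:E)%E
    @[n --> \oo] --> K ->
  (\int[mu]_x ((x - x0) ^+ 2 * sqn (f x))%:E <= K)%E.
Proof.
move=> fg h0 hcvg Kcvg.
have [/CLfun_measurable mf _ _] := fg.
have msf := measurable_sqn mf.
have mth n : Cmeasurable (fun x => expi (h n * (x - x0)) - 1).
  apply: CmeasurableB; last exact: Cmeasurable_cst.
  apply: (Cmeasurable_comp _ (@Cmeasurable_expi R)).
  by apply: measurable_funM => //; exact: measurable_funB.
pose F n x := ((h n)^-1 ^+ 2 * sqn (f x * (expi (h n * (x - x0)) - 1)))%:E.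
apply: (@fatou_cvg _ _ _ mu setT F _ _ K _ _ _ _ _ _ Kcvg) => //.
- move=> n; rewrite /F; under eq_fun do rewrite EFinM.
  by apply: measurable_funeM; apply: measurable_sqn; exact: CmeasurableM.
- apply/measurable_EFinP/measurable_funM; last exact/measurable_EFinP.
  by apply: measurable_funX; exact: measurable_funB.
- by move=> n x _; rewrite lee_fin mulr_ge0 ?sqn_ge0 ?sqr_ge0.
- apply: aeW => x _; rewrite /F; apply: cvg_EFin; first exact: nearW.
  have : (h n)^-1 ^+ 2 * sqn (expi (h n * (x - x0)) - 1) * sqn (f x) @[n --> \oo]
      --> (x - x0) ^+ 2 * sqn (f x).
    by apply: cvgM; [exact: sqn_expiB1_cvg|exact: cvg_cst].
  apply: cvg_trans; apply: near_eq_cvg; apply: nearW => n /=.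
  by rewrite ?fctE/= sqnM; ring.
- move=> n; rewrite /F; under eq_integral do rewrite EFinM.
  rewrite ge0_integralZl//; last 3 first.
  + by apply: measurable_sqn; exact: CmeasurableM.
  + by move=> x _; rewrite lee_fin sqn_ge0.
  + by rewrite lee_fin sqr_ge0.
  apply: lee_wpmul2l; first by rewrite lee_fin sqr_ge0.
  exact: fourierL2_modulation_le.
Qed.

Lemma isCk_derivable k (f : R -> R) : (1 <= k)%N -> isCk k f ->
  forall x, derivable f x 1.
Proof. by move=> k1 [df _]; exact: (df 0%N k1). Qed.

Lemma derivable_continuous (f : R -> R) : (forall x, derivable f x 1) -> continuous f.
Proof. by move=> df x; apply: differentiable_continuous; apply/derivable1_diffP. Qed.

Lemma isCk_continuous_derive1 k (f : R -> R) : (1 <= k)%N -> isCk k f ->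
  continuous (derive1 f).
Proof.
case: k => [//|[|k]] _ [df cf]; first exact: cf.
by apply: derivable_continuous; exact: (df 1%N).
Qed.

(** This supplies an integrable dominating function for the difference quotients. If [q] is outside
    [-2, 2] and [eta] is at most 1, both [q] and [q - eta] lie outside [-1, 1]; otherwise the mean
    value theorem applies. *)
Lemma diffq_bounded k (g : R -> R) : (1 <= k)%N -> isCk k g ->
  (forall x, x \notin `[-1, 1] -> g x = 0) ->
  exists2 M : R, 0 <= M & forall (eta q : R), 0 < eta -> eta <= 1 ->
    `|g (q - eta) - g q| <= eta * (M * \1_(`[-2, 2]%classic : set R) q).
Proof.
move=> k1 gk g0.
have dg := isCk_derivable k1 gk; have cg := isCk_continuous_derive1 k1 gk.
(* For [q] in [-2, 2] and [eta] at most 1, every intermediate point between [q - eta] and [q] lies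
   in [-3, 2]. *)
have cg' : {within `[-3, 2], continuous (fun x : R => `|derive1 g x|)}.
  by apply: continuous_subspaceT => x; apply: cvg_norm; exact: cg.
have [|c _ cmax] := EVT_max _ cg'; first by lra.
exists `|derive1 g c| => // eta q eta0 eta1.
rewrite indicE; have [|] := boolP (q \in _).
  rewrite inE/= in_itv/= => /andP[q2 q2'].
  have lt : q - eta < q by rewrite ltrBlDr ltrDl.
  have [|d|d] := MVT lt (f := g) (df := derive1 g).
  - by move=> x _; rewrite derive1E; apply/derivableP.
  - by apply: continuous_subspaceT; exact: derivable_continuous.
  rewrite in_itv/= => /andP[d1 d2] gd.
  rewrite distrC gd mulr1 normrM mulrC (_ : q - (q - eta) = eta); last by ring.
  rewrite (gtr0_norm eta0) ler_wpM2l ?(ltW eta0)//.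
  by apply: cmax; rewrite in_itv/=; apply/andP; split; lra.
rewrite notin_setE/= in_itv/= => /negP; rewrite negb_and -!ltNge => nq.
rewrite g0; last by rewrite in_itv/= negb_and -!ltNge; case/orP: nq => nq; apply/orP; [left|right]; lra.
rewrite g0; last by rewrite in_itv/= negb_and -!ltNge; case/orP: nq => nq; apply/orP; [left|right]; lra.
by rewrite subrr normr0 !mulr0.
Qed.

Lemma integral_diffq_cvg k (v : R -> R[i]) : (1 <= k)%N -> CisCk k v ->
  supp v `<=` `[-1, 1] ->
  (\int[mu]_q ((n.+1%:R) ^+ 2 * sqn (v (q - n.+1%:R^-1) - v q)%R)%:E)%E @[n --> \oo]
  --> (\int[mu]_q (sqn (Cderive1 v q))%:E)%E.
Proof.
move=> k1 [vr vi] sv.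
have v0 x : x \notin `[-1, 1] -> v x = 0.
  apply: contraNeq => vx; have : supp v x by apply: subset_closure.
  by move/sv.
have [M1 M10 HM1] := diffq_bounded k1 vr (fun x hx => congr1 (@complex.Re R) (v0 x hx)).
have [M2 M20 HM2] := diffq_bounded k1 vi (fun x hx => congr1 (@complex.Im R) (v0 x hx)).
have mv : Cmeasurable v.
  by split; apply: continuous_measurableT; apply: derivable_continuous;
    [exact: isCk_derivable vr|exact: isCk_derivable vi].
have mv' : Cmeasurable (Cderive1 v).
  by split; apply: continuous_measurableT; [exact: isCk_continuous_derive1 vr|
    exact: isCk_continuous_derive1 vi].
pose G q : \bar R := ((M1 ^+ 2 + M2 ^+ 2) * \1_(`[-2, 2]%classic : set R) q)%:E.
have iG : mu.-integrable setT G.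
  exact: (integrableZl measurableT _ (integrable_indic_itv _ _ _ _)).
have e0 n : 0 < n.+1%:R^-1 :> R by rewrite invr_gt0.
have e1 n : n.+1%:R^-1 <= 1 :> R by rewrite invf_le1// ler1n.
have [] := @dominated_convergence _ _ _ mu setT measurableT
  (fun n q => ((n.+1%:R) ^+ 2 * sqn (v (q - n.+1%:R^-1) - v q)%R)%:E)
  (fun q => (sqn (Cderive1 v q))%:E) G.
- move=> n; under eq_fun do rewrite EFinM; apply: measurable_funeM.
  apply: measurable_sqn; apply: CmeasurableB => //.
  by apply: (Cmeasurable_comp _ mv); exact: measurable_funB.
- exact: measurable_sqn.
- apply: aeW => q _; apply: cvg_EFin; first exact: nearW.
  (* The increment is negative, but the sign of the quotient disappears on squaring. *)
  have un0 n : - (n.+1%:R^-1 : R) != 0 by rewrite oppr_eq0 gt_eqF.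
  have ucvg : - (n.+1%:R^-1 : R) @[n --> \oo] --> 0.
    by rewrite -oppr0; apply: cvgN; exact: invSn_cvg0.
  have dr : derivable (fun x => complex.Re (v x)) q 1 by exact: (isCk_derivable k1 vr).
  have di : derivable (fun x => complex.Im (v x)) q 1 by exact: (isCk_derivable k1 vi).
  have rc := diffq_cvg dr un0 ucvg.
  have ic := diffq_cvg di un0 ucvg.
  rewrite /sqn/=; rewrite !expr2.
  apply: cvg_trans (cvgD (cvgM rc rc) (cvgM ic ic)).
  apply: near_eq_cvg; apply: nearW => n /=.
  by rewrite !fctE/= !ReB !ImB; field.
- exact: iG.
- apply: aeW => q n _; rewrite abse_EFin ger0_norm ?mulr_ge0 ?sqr_ge0 ?sqn_ge0// lee_fin.
  have := HM1 _ q (e0 n) (e1 n); have := HM2 _ q (e0 n) (e1 n).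
  rewrite /sqn ReB ImB.
  have nn : n.+1%:R * n.+1%:R^-1 = 1 :> R by rewrite divff.
  have n0 : 0 <= n.+1%:R :> R by rewrite ler0n.
  rewrite indicE; case: (_ \in _); rewrite ?mulr1 ?mulr0 => h2 h1; last first.
    move: h1 h2; rewrite !normr_le0 => /eqP -> /eqP ->.
    by rewrite expr0n/= addr0 mulr0.
  rewrite mulrDr -!exprMn lerD//.
    rewrite -real_normK ?num_real// ler_pXn2r ?nnegrE//.
      by rewrite normrM (ger0_norm n0) (le_trans (ler_wpM2l n0 h1))// mulrA nn mul1r.
  rewrite -real_normK ?num_real// ler_pXn2r ?nnegrE//.
    by rewrite normrM (ger0_norm n0) (le_trans (ler_wpM2l n0 h2))// mulrA nn mul1r.
by [].
Qed.

End weighted_bound.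

(** * Functions of class C^k *)

Section Ck_calculus.
Context {R : realType}.
Implicit Types (f g : R -> R).

Lemma isCk0 f : isCk 0 f <-> continuous f.
Proof. by split => [[]//|cf]; split. Qed.

(** The recursive description of the class, on which the inductions below rest. *)
Lemma isCkS k f : isCk k.+1 f <-> (forall x, derivable f x 1) /\ isCk k (derive1 f).
Proof.
split=> [[df cf]|[df [d'f cf]]]; split => //.
- exact: (df 0%N).
- split; last by rewrite -derive1Sn.
  by move=> j jk x; rewrite -derive1Sn; exact: df.
- by case=> [|j] jk x; [exact: df|rewrite derive1Sn; exact: d'f].
- by rewrite derive1Sn.
Qed.

Lemma isCkW k f : isCk k.+1 f -> isCk k f.
Proof.
move=> [df cf]; split; first by move=> j jk; apply: df; exact: ltnW.
by apply: derivable_continuous; exact: df.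
Qed.

Lemma isCkD k f g : isCk k f -> isCk k g -> isCk k (fun x => f x + g x).
Proof.
elim: k f g => [|k IH] f g.
  by rewrite !isCk0 => cf cg x; apply: cvgD; [exact: cf|exact: cg].
rewrite !isCkS => -[df f'] [dg g'].
have -> : derive1 (fun x => f x + g x) = fun x => derive1 f x + derive1 g x.
  by apply/funext => x; rewrite !derive1E; exact: deriveD.
by split; [move=> x; exact: derivableD|exact: IH].
Qed.

(** In the product rule [f] and [g] occur undifferentiated next to derivatives of class [k], hence
    the appeal to [isCkW]. *)
Lemma isCkM k f g : isCk k f -> isCk k g -> isCk k (fun x => f x * g x).
Proof.
elim: k f g => [|k IH] f g.
  by rewrite !isCk0 => cf cg x; apply: cvgM; [exact: cf|exact: cg].
move=> kf kg; have := isCkW kf; have := isCkW kg; move: kf kg.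
rewrite !isCkS => -[df f'] [dg g'] gk fk.
have -> : derive1 (fun x => f x * g x) = fun x => f x * derive1 g x + g x * derive1 f x.
  by apply/funext => x; rewrite !derive1E; exact: deriveM.
split; first by move=> x; exact: derivableM.
by apply: isCkD; exact: IH.
Qed.

(** The factor [c] makes the statement inductive: the chain rule turns it into [c * al]. *)
Lemma isCk_affine k f (c al be : R) : isCk k f -> isCk k (fun x => c * f (al * x + be)).
Proof.
elim: k f c => [|k IH] f c.
  rewrite !isCk0 => cf x; apply: cvgM; first exact: cvg_cst.
  by apply: continuous_comp; [exact: continuous_affine|exact: cf].
rewrite !isCkS => -[df f'].
have dfa x : is_derive x (1 : R) (fun x => c * f (al * x + be)) (c * al * derive1 f (al * x + be)).
  have d1 : is_derive x (1 : R) (fun x : R => al * x + be) al.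
    by apply: is_derive_eq; rewrite /GRing.scale/= mulr1 addr0.
  have d2 : is_derive (al * x + be) (1 : R) f (derive1 f (al * x + be)).
    by rewrite derive1E; exact/derivableP.
  have d3 : is_derive x (1 : R) (fun x => f (al * x + be)) (derive1 f (al * x + be) * al).
    exact: (@is_derive1_comp _ f (fun x => al * x + be) x _ _ d2 d1).
  by apply: is_derive_eq; rewrite /GRing.scale/=; ring.
split; first by move=> x; case: (dfa x).
have -> : derive1 (fun x => c * f (al * x + be)) = fun x => c * al * derive1 f (al * x + be).
  by apply/funext => x; rewrite derive1E (@derive_val _ _ _ _ _ _ _ (dfa x)).
exact: IH.
Qed.

(** The span of [cos (w * x)] and [sin (w * x)] is stable under differentiation, so the induction
    runs over both coefficients at once. *)
Lemma isCk_trigo k (c s w : R) : isCk k (fun x => c * cos (w * x) + s * sin (w * x)).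
Proof.
have dT c' s' x : is_derive x (1 : R) (fun x => c' * cos (w * x) + s' * sin (w * x))
    ((s' * w) * cos (w * x) + (- c' * w) * sin (w * x)).
  by apply: is_derive_eq; rewrite /GRing.scale/=; ring.
elim: k c s => [|k IH] c s.
  by rewrite isCk0; apply: derivable_continuous => x; case: (dT c s x).
rewrite isCkS; split; first by move=> x; case: (dT c s x).
rewrite (_ : derive1 _ = fun x => (s * w) * cos (w * x) + (- c * w) * sin (w * x)).
  exact: IH.
by apply/funext => x; rewrite derive1E (@derive_val _ _ _ _ _ _ _ (dT c s x)).
Qed.

Lemma CisCk_modulation k (v : R -> R[i]) (al be x0 : R) : CisCk k v ->
  CisCk k (fun p => v (al * p + be) * expi (- (x0 * p))).
Proof.
move=> [vr vi].
have kc : isCk k (fun p => cos (- (x0 * p))).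
  rewrite (_ : (fun p => _) = fun p => 1 * cos (- x0 * p) + 0 * sin (- x0 * p)).
    exact: isCk_trigo.
  by apply/funext => p; rewrite mulNr; ring.
have ks c : isCk k (fun p => c * sin (- (x0 * p))).
  rewrite (_ : (fun p => _) = fun p => 0 * cos (- x0 * p) + c * sin (- x0 * p)).
    exact: isCk_trigo.
  by apply/funext => p; rewrite mulNr; ring.
have kr := isCk_affine 1 al be vr; have ki := isCk_affine 1 al be vi.
split.
  have := isCkD (isCkM kr kc) (isCkM ki (ks (-1))).
  by congr isCk; apply/funext => p; rewrite ReM/=; ring.
have := isCkD (isCkM kr (ks 1)) (isCkM ki kc).
by congr isCk; apply/funext => p; rewrite ImM/=; ring.
Qed.

End Ck_calculus.

Theorem proposition3p2 (R : realType) (k : nat) (a b x0 : R) (v : R -> R[i])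
    (V Vhat : R -> R[i]) :
  (1 <= k)%N -> a < b ->
  CisCk k v -> supp v `<=` `[-1, 1] ->
  CLfun 2%:E V -> is_fourierL2 V Vhat ->
  (forall p : R,
     Vhat p = v ((2 * p - (a + b)) / (b - a)) * expi (- (x0 * p))) ->
  [/\ CisCk k Vhat,
      supp Vhat `<=` `[a, b] &
      forall c : R, 0 < c ->
        (\int[leb R]_(x in [set x : R | (c <= `|x - x0|)%R]) ((ComplexField.Normc.normc (V x) ^+ 2)%R)%:E
         <= (2 / c ^+ 2 * (1 / (b - a)))%R%:E
            * CLnorm 2%:E (Cderive1 v) ^+ 2)%E].
Proof.
move=> k1 ab vk sv VL FV VhatE.
have ba : 0 < b - a by rewrite subr_gt0.
(* The affine map [al * p + be] is the argument of [v] in [Vhat]; it sends [a, b] onto [-1, 1]. *)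
pose al := 2 / (b - a); pose be := - (a + b) / (b - a).
have al0 : 0 < al by rewrite divr_gt0.
have VE p : Vhat p = v (al * p + be) * expi (- (x0 * p)).
  by rewrite VhatE; congr (v _ * _); rewrite /al /be; ring.
have mv : Cmeasurable v.
  have [vr vi] := vk.
  by split; apply: continuous_measurableT; apply: derivable_continuous;
    [exact: (isCk_derivable k1 vr)|exact: (isCk_derivable k1 vi)].
split.
- by rewrite (funext VE); exact: CisCk_modulation.
- have clab : closed (`[a, b]%classic : set R) by exact: interval_closed.
  rewrite /supp [X in _ `<=` X](closure_id _).1//; apply: closure_subset => p /=.
  rewrite VhatE in_itv/= => /eqP vp.
  have : supp v ((2 * p - (a + b)) / (b - a)).
    apply: subset_closure => /=; apply/eqP => v0; apply: vp.
    by rewrite v0 mul0r.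
  move/sv; rewrite /= in_itv/= ler_pdivlMr// ler_pdivrMr//; lra.
move=> c c0; rewrite CLnorm2_sqr.
set S := (\int[leb R]_x _)%E.
(* A translation of [p] by [h n] shifts the argument of [v] by exactly [1 / (n + 1)]. *)
pose h n : R := n.+1%:R^-1 / al.
have h0 n : h n != 0 by rewrite mulf_neq0// invr_eq0// gt_eqF.
have hcvg : h @ \oo --> 0.
  by rewrite -(mul0r al^-1); apply: cvgM; [exact: invSn_cvg0|exact: cvg_cst].
(* The square of the inverse of [h n] is [(n + 1)^2 * al^2], and the change of variable divides by
   [al], so one factor [al] remains. *)
have energy n : (((h n)^-1 ^+ 2)%:E *
    \int[leb R]_p (sqn (expi (- (h n * x0)) * Vhat (p - h n) - Vhat p)%R)%:E =
    al%:E * \int[leb R]_q ((n.+1%:R) ^+ 2 * sqn (v (q - n.+1%:R^-1) - v q)%R)%:E)%E.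
  pose G q := (sqn (v (q - n.+1%:R^-1) - v q))%:E.
  have mG : measurable_fun setT G.
    apply: measurable_sqn; apply: CmeasurableB => //.
    by apply: (Cmeasurable_comp _ mv); exact: measurable_funB.
  have G0 q : (0 <= G q)%E by rewrite lee_fin sqn_ge0.
  rewrite (_ : (\int[leb R]_p _)%E = (\int[leb R]_p G (al * p + be)%R)%E); last first.
    apply: eq_integral => p _; rewrite /G !VE; congr EFin.
    rewrite (_ : al * (p - h n) + be = al * p + be - n.+1%:R^-1); last first.
      rewrite /h; field; rewrite ?gt_eqF//.
    (* The phase of the translate, once multiplied by [expi (- (h n * x0))], is that of [Vhat p]: a
       common factor of modulus 1 comes out. *)
    rewrite mulrCA -expiD.
    rewrite (_ : - (h n * x0) + - (x0 * (p - h n)) = - (x0 * p)); last by ring.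
    by rewrite -mulrBl sqnM sqn_expi mulr1.
  rewrite ge0_integral_affine// muleA -EFinM.
  under [in RHS]eq_integral do rewrite EFinM.
  rewrite [in RHS]ge0_integralZl//; last by move=> q _; exact: G0.
  rewrite muleA -EFinM; congr (_%:E * _)%E.
  rewrite /h; field; rewrite ?gt_eqF//.
have W := fourierL2_weighted_le FV h0 hcvg.
have {}W : (\int[leb R]_x ((x - x0) ^+ 2 * sqn (V x))%:E <= al%:E * S)%E.
  apply: W; under eq_fun do rewrite energy.
  by apply: cvgeZl => //; exact: (integral_diffq_cvg k1 vk sv).
have mV := CLfun_measurable VL.
have c2 : 0 < c ^+ 2 by rewrite exprn_gt0.
rewrite (_ : 2 / c ^+ 2 * (1 / (b - a)) = (c ^+ 2)^-1 * al); last first.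
  by rewrite /al; field; rewrite ?gt_eqF.
rewrite EFinM -muleA.
apply: (@le_trans _ _ (((c ^+ 2)^-1)%:E * \int[leb R]_x ((x - x0) ^+ 2 * sqn (V x))%:E)%E); last first.
  by apply: lee_wpmul2l W; rewrite lee_fin invr_ge0 ltW.
have mW : measurable_fun setT (fun x : R => ((x - x0) ^+ 2 * sqn (V x))%:E).
  apply/measurable_EFinP/measurable_funM; last by apply/measurable_EFinP; exact: measurable_sqn.
  by apply: measurable_funX; exact: measurable_funB.
rewrite -ge0_integralZl//; last 2 first.
- by move=> x _; rewrite lee_fin mulr_ge0 ?sqr_ge0 ?sqn_ge0.
- by rewrite lee_fin invr_ge0 ltW.
have mD : measurable [set x : R | c <= `|x - x0|].
  have mN : measurable_fun setT (fun x : R => `|x - x0|).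
    by apply: measurableT_comp => //; exact: measurable_funB.
  rewrite (_ : [set x : R | c <= `|x - x0|] = setT `&` (fun x => `|x - x0|) @^-1` `[c, +oo[%classic).
    exact: mN.
  by rewrite setTI; apply/seteqP; split => x /=; rewrite in_itv/= andbT.
(* Chebyshev's inequality, pointwise: on the domain of integration [(x - x0) ^+ 2 / c ^+ 2] is at
   least 1, and elsewhere the left-hand integrand is 0. *)
rewrite [leLHS]integral_mkcond; apply: ge0_le_integral => //.
- by move=> x _; rewrite patchE; case: ifPn => // _; rewrite lee_fin sqr_ge0.
- apply/(measurable_restrictT _ _).1 => //; apply: measurable_funTS.
  by under eq_fun do rewrite normc_sqr; exact: measurable_sqn.
- exact: measurable_funeM.
move=> x _; rewrite patchE; case: ifPn => [|_].
  rewrite inE/= => cx; rewrite -EFinM lee_fin normc_sqr mulrA ler_peMl ?sqn_ge0//.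
  rewrite mulrC ler_pdivlMr// mul1r -(real_normK (num_real (x - x0))).
  by rewrite ler_pXn2r ?nnegrE// ltW.
by rewrite -EFinM lee_fin mulr_ge0 ?invr_ge0 ?(ltW c2)// mulr_ge0 ?sqr_ge0 ?sqn_ge0.
Qed.
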